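(* Let $K$ be a field, $R = K[x_1, x_2, x_3]$ with the standard grading, and $I = (x_1x_2, x_1x_3, x_2x_3)$. Then the graded minimal free resolution of $R/I$ is of the form \[ 0 \to R(-3)^2 \to R(-2)^3 \to R \to 0. \] For $s \geq 2$, the graded minimal free resolution of $R/I^s$ is of the form \[0 \to R(-2s-2)^{\binom{s}{2}} \to R(-2s-1)^{2\binom{s+1}{2}} \to R(-2s)^{\binom{s+2}{2}} \to R \to 0, \] so that $\operatorname{reg}_R (I^s)=2s$. Moreover, the Hilbert series of $R/I^s$ is given by \[ H(R/I^s,t) = \frac{1+2t+3t^2+ \cdots +2st^{2s-1} - \left(\binom{s+2}{2}-2s-1 \right)t^{2s} }{1-t}. \]
   Context: For a finitely generated graded $R$-module $M$, $\operatorname{reg}_R(M)=\max\{j-i : \operatorname{Tor}_i^R(M,K)_j\neq 0\}$ is the Castelnuovo-Mumford regularity, and $H(M,t)=\sum_{j}\dim_K(M_j)\,t^j$ is the Hilbert series. *)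

(* Defs.v *)
From HB Require Import structures.
From mathcomp Require Import all_boot all_order all_algebra.
From mathcomp Require Import boolp.
From mathcomp Require Import mpoly.

Set Implicit Arguments.
Unset Strict Implicit.
Unset Printing Implicit Defensive.

Import GRing.Theory.
Local Open Scope ring_scope.

Section GradedAlgebra.

Variables (K : fieldType) (n : nat).
Local Notation R := {mpoly K[n]}.

(* The component of R = K[x_1, ..., x_n] of degree j, for an integer j. *)
Definition poly_part (j : int) (p : R) : Prop :=
  match j with
  | Posz d => p \is d.-homog
  | Negz _ => p = 0
  end.

Lemma poly_part0 j : poly_part j 0.
Proof. by case: j => d //=; exact: dhomog0. Qed.

Lemma poly_partB j p q : poly_part j p -> poly_part j q -> poly_part j (p - q).
Proof.
case: j => d /=; first exact: rpredB.
by move=> -> ->; rewrite subrr.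
Qed.

Lemma poly_partM i j p q :
  poly_part i p -> poly_part j q -> poly_part (i + j) (p * q).
Proof.
case: i => a; last by move=> /= ->; rewrite mul0r => _; exact: poly_part0.
case: j => b; last by move=> _ /= ->; rewrite mulr0; exact: poly_part0.
exact: dhomogM.
Qed.

Record grmod := GrMod {
  grmod_sort :> lmodType R;
  part : int -> grmod_sort -> Prop;
  part0 : forall j, part j 0;
  partB : forall j u v, part j u -> part j v -> part j (u - v);
  partZ : forall i j p v, poly_part i p -> part j v -> part (i + j) (p *: v);
  part_span : forall v, exists (s : seq int) (c : int -> grmod_sort),
    (forall j, part j (c j)) /\ v = \sum_(j <- s) c j;
  part_direct : forall (s : seq int) (c : int -> grmod_sort),
    uniq s -> (forall j, part j (c j)) -> \sum_(j <- s) c j = 0 ->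
    {in s, forall j, c j = 0}
}.

(* [grdim M j d] : the K-vector space M_j has dimension d, i.e. it has a basis
   with d elements; K acts on M through the constant polynomials. *)
Definition grdim (M : grmod) (j : int) (d : nat) : Prop :=
  exists b : 'I_d -> M,
    (forall k, part j (b k)) /\
    (forall v : M, part j v ->
       exists! c : {ffun 'I_d -> K}, v = \sum_(k < d) (c k)%:MP *: b k).

(* H(M, t) = \sum_(d >= 0) h d * t^d; no term of negative degree. *)
Definition hilbert_series (M : grmod) (h : nat -> nat) : Prop :=
  (forall d : nat, grdim M d%:Z (h d)) /\ (forall d : nat, grdim M (Negz d) 0).

(* The graded free modules F_i = \bigoplus_k R(- gshift i k), for i >= 0, with
   matrices F_(i+1) -> F_i acting on row vectors. *)
Record grfree := GrFree {
  grank : nat -> nat;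
  gshift : forall i, 'I_(grank i) -> int;
  gdiff : forall i, 'M[R]_(grank i.+1, grank i)
}.

Definition free_part (F : grfree) (i : nat) (j : int)
    (v : 'rV[R]_(grank F i)) : Prop :=
  forall k, poly_part (j - gshift k) (v 0 k).

Definition augmented_resolution (F : grfree) (M : grmod)
    (eps : {linear 'rV[R]_(grank F 0) -> M}) : Prop :=
  [/\ forall i j v, free_part (i := i.+1) j v ->
        free_part (i := i) j (v *m gdiff F i),
      forall j v, free_part (i := 0) j v -> part j (eps v),
      forall u : M, exists v, eps v = u,
      forall v, eps v = 0 <-> exists w, v = w *m gdiff F 0
    & forall i (v : 'rV[R]_(grank F i.+1)),
        v *m gdiff F i = 0 <-> exists w, v = w *m gdiff F i.+1].

Definition graded_resolution (F : grfree) (M : grmod) : Prop :=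
  exists eps, @augmented_resolution F M eps.

(* d (F_(i+1)) is contained in (x_1, ..., x_n) F_i *)
Definition minimal (F : grfree) : Prop :=
  forall i k l, (gdiff F i k l)@_0%MM = 0.

(* F_i = R(- a_i)^(b_i) for l = [:: (b_0, a_0); (b_1, a_1); ...], and F_i = 0
   for i >= size l. *)
Definition has_form (F : grfree) (l : seq (nat * int)) : Prop :=
  forall i, grank F i = (nth (0%N, 0) l i).1 /\
    forall k : 'I_(grank F i), gshift k = (nth (0%N, 0) l i).2.

(* M has a graded minimal free resolution, and every such resolution is of the
   form l. *)
Definition minimal_resolution_form (M : grmod) (l : seq (nat * int)) : Prop :=
  (exists F, graded_resolution F M /\ minimal F) /\
  (forall F, graded_resolution F M -> minimal F -> has_form F l).

(* The differential of F (x)_R K, where K = R / (x_1, ..., x_n). *)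
Definition tensor_diff (F : grfree) (i : nat) :
  'M[K]_(grank F i.+1, grank F i) := map_mx (mcoeff 0%MM) (gdiff F i).

Definition tensor_part (F : grfree) (i : nat) (j : int)
    (v : 'rV[K]_(grank F i)) : Prop :=
  forall k, v 0 k != 0 -> gshift k = j.

Definition tensor_cycle (F : grfree) (i : nat) :
    'rV[K]_(grank F i) -> Prop :=
  match i with
  | 0 => fun _ => True
  | i'.+1 => fun v => v *m tensor_diff F i' = 0
  end.

Definition tensor_boundary (F : grfree) (i : nat) (j : int)
    (v : 'rV[K]_(grank F i)) : Prop :=
  exists w, tensor_part (i := i.+1) j w /\ v = w *m tensor_diff F i.

(* Tor_i^R(M, K)_j <> 0, Tor being the homology of F (x)_R K for a graded free
   resolution F of M. *)
Definition Tor_neq0 (M : grmod) (i : nat) (j : int) : Prop :=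
  exists F, graded_resolution F M /\
    exists v : 'rV[K]_(grank F i),
      [/\ tensor_part j v, tensor_cycle v & ~ tensor_boundary j v].

(* reg_R(M) = r; a maximum, hence in particular attained. *)
Definition is_regularity (M : grmod) (r : int) : Prop :=
  (exists i j, Tor_neq0 M i j /\ j - i%:Z = r) /\
  (forall i j, Tor_neq0 M i j -> (j - i%:Z <= r)%R).

Record hideal := HIdeal {
  hmem : {pred R};
  hmem0 : 0 \in hmem;
  hmemP : forall a, {in hmem &, forall p q, a * p + q \in hmem};
  hmem_homog : forall d, {in hmem, forall p, pihomog mdeg d p \in hmem}
}.

Lemma hmem_submod (I : hideal) : @GRing.submod_closed R R^o (hmem I).
Proof. by split; [exact: hmem0 | exact: hmemP]. Qed.

HB.instance Definition _ (I : hideal) :=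
  GRing.isSubmodClosed.Build R R^o (hmem I) (hmem_submod I).

Lemma hmem_zmod (I : hideal) : @GRing.zmod_closed R (hmem I).
Proof. exact: (@GRing.submod_closedB _ _ _ (hmem_submod I)). Qed.

HB.instance Definition _ (I : hideal) :=
  GRing.isZmodClosed.Build R (hmem I) (hmem_zmod I).

Lemma hmemMl (I : hideal) a p : p \in hmem I -> a * p \in hmem I.
Proof. by move=> Ip; rewrite -[a * p]addr0 hmemP ?hmem0. Qed.

Lemma pihomogM_mem (I : hideal) (a b : R) d :
  (forall i j, pihomog mdeg i a * pihomog mdeg j b \in hmem I) ->
  pihomog mdeg d (a * b) \in hmem I.
Proof.
move=> Iab.
rewrite (pihomog_partitionE (leqnn (mmeasure mdeg a))) big_distrl linear_sum /=.
apply: rpred_sum => i _.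
rewrite {1}(pihomog_partitionE (leqnn (mmeasure mdeg b))) big_distrr linear_sum /=.
apply: rpred_sum => j _.
have hab := dhomogM (pihomogP mdeg i a) (pihomogP mdeg j b).
case: (eqVneq (i + j)%N d) => [<-|ne]; first by rewrite pihomog_dE.
by rewrite (pihomog_ne0 ne hab) rpred0.
Qed.

(* The component of p of degree j. *)
Definition polyz (j : int) (p : R) : R :=
  match j with
  | Posz d => pihomog mdeg d p
  | Negz _ => 0
  end.

Lemma polyzP j p : poly_part j (polyz j p).
Proof. by case: j => d //=; exact: pihomogP. Qed.

Lemma polyz_part i j p : poly_part i p ->
  polyz j p = if i == j then p else 0.
Proof.
case: i => a /=; last first.
  by move=> ->; case: j => b /=; rewrite ?raddf0 ?if_same.
case: j => b //= hp; rewrite eqz_nat.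
by case: eqVneq => [<-|ne]; [rewrite pihomog_dE | rewrite (pihomog_ne0 ne hp)].
Qed.

Lemma polyz_mem (I : hideal) j p : p \in hmem I -> polyz j p \in hmem I.
Proof. by case: j => d //= Ip; [exact: hmem_homog | exact: hmem0]. Qed.

Lemma polyz_sum j (s : seq int) (c : int -> R) :
  polyz j (\sum_(i <- s) c i) = \sum_(i <- s) polyz j (c i).
Proof. by case: j => d /=; [exact: linear_sum | rewrite big1]. Qed.

Lemma polyz_uniq_sum j (s : seq int) (c : int -> R) :
  uniq s -> (forall i, poly_part i (c i)) -> j \in s ->
  polyz j (\sum_(i <- s) c i) = c j.
Proof.
move=> us hc js; rewrite polyz_sum (bigD1_seq j) //= (polyz_part _ (hc j)) eqxx.
by rewrite big1 ?addr0 // => i ne; rewrite (polyz_part _ (hc i)) (negPf ne).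
Qed.

Lemma polyz_span p : exists s : seq int, p = \sum_(j <- s) polyz j p.
Proof.
exists [seq Posz d | d <- iota 0 (mmeasure mdeg p)].
rewrite big_map /= {1}(pihomog_partitionE (leqnn (mmeasure mdeg p))).
by rewrite -(big_mkord xpredT (fun d => pihomog mdeg d p)) /index_iota subn0.
Qed.

Record ideal_sub (I : hideal) := IdealSub {
  ideal_val :> R^o;
  _ : ideal_val \in hmem I
}.

HB.instance Definition _ (I : hideal) := [isSub for @ideal_val I].
HB.instance Definition _ (I : hideal) := [Choice of ideal_sub I by <:].
HB.instance Definition _ (I : hideal) :=
  GRing.SubChoice_isSubLmodule.Build R R^o _ (ideal_sub I)
    (GRing.submod_closed_semi (hmem_submod I)).

Section IdealModule.

Variable I : hideal.

Definition ideal_part (j : int) (u : ideal_sub I) : Prop := poly_part j (val u).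

Fact ideal_part0 j : ideal_part j 0.
Proof. by rewrite /ideal_part raddf0; exact: poly_part0. Qed.

Fact ideal_partB j u v : ideal_part j u -> ideal_part j v -> ideal_part j (u - v).
Proof. by rewrite /ideal_part raddfB; exact: poly_partB. Qed.

Fact ideal_partZ i j p v :
  poly_part i p -> ideal_part j v -> ideal_part (i + j) (p *: v).
Proof. by rewrite /ideal_part linearZ; exact: poly_partM. Qed.

Fact ideal_part_span v : exists (s : seq int) (c : int -> ideal_sub I),
  (forall j, ideal_part j (c j)) /\ v = \sum_(j <- s) c j.
Proof.
have [s hs] := polyz_span (val v).
exists s, (fun j => IdealSub (polyz_mem j (valP v))); split.
  by move=> j; exact: polyzP.
by apply: val_inj; rewrite raddf_sum /= {1}hs.
Qed.

Fact ideal_part_direct (s : seq int) (c : int -> ideal_sub I) :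
  uniq s -> (forall j, ideal_part j (c j)) -> \sum_(j <- s) c j = 0 ->
  {in s, forall j, c j = 0}.
Proof.
move=> us hc /(congr1 val); rewrite !raddf_sum raddf0 /= => h j js.
apply: val_inj; rewrite raddf0.
rewrite -[LHS](polyz_uniq_sum (c := fun j => val (c j)) us hc js) h.
by case: {hc js} j => d //=; rewrite raddf0.
Qed.

Definition ideal_mod : grmod :=
  GrMod ideal_part0 ideal_partB ideal_partZ ideal_part_span ideal_part_direct.

End IdealModule.

Section QuotientModule.

Variable I : hideal.

Definition quot_sort := Quotient.quot (hmem I : zmodClosed R).

HB.instance Definition _ := GRing.Zmodule.on quot_sort.

Definition quot_pi (p : R) : quot_sort := (\pi_quot_sort p)%qT.

Definition quot_repr (x : quot_sort) : R := repr x.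

Lemma quot_reprK : cancel quot_repr quot_pi.
Proof. exact: reprK. Qed.

Lemma quot_piD : {morph quot_pi : p q / p + q}.
Proof. exact: raddfD. Qed.

Lemma quot_pi_eq p q : quot_pi p = quot_pi q <-> p - q \in hmem I.
Proof.
rewrite (@Quotient.idealrBE R (hmem I : zmodClosed R)).
by split=> [h|/eqP //]; apply/eqP.
Qed.

Definition quot_scale (a : R) (x : quot_sort) : quot_sort :=
  quot_pi (a * quot_repr x).

Lemma quot_scaleE a p : quot_scale a (quot_pi p) = quot_pi (a * p).
Proof.
apply/quot_pi_eq; rewrite -mulrBr hmemMl //.
by apply/quot_pi_eq; rewrite quot_reprK.
Qed.

Fact quot_scaleA a b x : quot_scale a (quot_scale b x) = quot_scale (a * b) x.
Proof. by rewrite -[x]quot_reprK !quot_scaleE mulrA. Qed.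

Fact quot_scale1 : left_id 1 quot_scale.
Proof. by move=> x; rewrite -[x]quot_reprK quot_scaleE mul1r. Qed.

Fact quot_scaleDr : right_distributive quot_scale +%R.
Proof.
move=> a x y; rewrite -[x]quot_reprK -[y]quot_reprK -quot_piD !quot_scaleE.
by rewrite mulrDr quot_piD.
Qed.

Fact quot_scaleDl x : {morph quot_scale^~ x : a b / a + b}.
Proof.
by move=> a b; rewrite -[x]quot_reprK !quot_scaleE mulrDl quot_piD.
Qed.

HB.instance Definition _ := GRing.Zmodule_isLmodule.Build R quot_sort
  quot_scaleA quot_scale1 quot_scaleDr quot_scaleDl.

Lemma quot_pi_zmod : zmod_morphism quot_pi.
Proof. exact: raddfB. Qed.

HB.instance Definition _ :=
  GRing.isZmodMorphism.Build R quot_sort quot_pi quot_pi_zmod.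

(* (R/I)_j is the image of R_j. *)
Definition quot_part (j : int) (x : quot_sort) : Prop :=
  exists2 p, poly_part j p & x = quot_pi p.

Fact quot_part0 j : quot_part j 0.
Proof. by exists 0; [exact: poly_part0 | rewrite raddf0]. Qed.

Fact quot_partB j x y : quot_part j x -> quot_part j y -> quot_part j (x - y).
Proof.
move=> [p hp ->] [q hq ->]; exists (p - q); first exact: poly_partB.
by rewrite raddfB.
Qed.

Fact quot_partZ i j p x :
  poly_part i p -> quot_part j x -> quot_part (i + j) (p *: x).
Proof.
move=> hp [q hq ->]; exists (p * q); first exact: poly_partM.
exact: quot_scaleE.
Qed.

Fact quot_part_span x : exists (s : seq int) (c : int -> quot_sort),
  (forall j, quot_part j (c j)) /\ x = \sum_(j <- s) c j.
Proof.
have [s hs] := polyz_span (quot_repr x).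
exists s, (fun j => quot_pi (polyz j (quot_repr x))); split.
  by move=> j; exists (polyz j (quot_repr x)) => //; exact: polyzP.
by rewrite -[LHS]quot_reprK {1}hs raddf_sum.
Qed.

Fact quot_part_direct (s : seq int) (c : int -> quot_sort) :
  uniq s -> (forall j, quot_part j (c j)) -> \sum_(j <- s) c j = 0 ->
  {in s, forall j, c j = 0}.
Proof.
move=> us hc h j js.
have {hc}/choice[q hq] : forall i, exists p, poly_part i p /\ c i = quot_pi p.
  by move=> i; have [p] := hc i; exists p.
have Iq : \sum_(i <- s) q i \in hmem I.
  rewrite -[X in X \in _]subr0; apply/quot_pi_eq; rewrite (raddf0 quot_pi) -[RHS]h.
  by rewrite (raddf_sum quot_pi); apply: eq_bigr => i _; case: (hq i).
rewrite (hq j).2 -(raddf0 quot_pi); apply/quot_pi_eq; rewrite subr0.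
rewrite -(polyz_uniq_sum us (fun i => (hq i).1) js).
exact: polyz_mem.
Qed.

Definition quot_mod : grmod :=
  GrMod quot_part0 quot_partB quot_partZ quot_part_span quot_part_direct.

End QuotientModule.

Section GeneratedIdeal.

Variables (G : seq R) (homogG : all (fun g => g \is homog mdeg) G).

Definition gen_mem : {pred R} := [pred p |
  `[< exists a : 'I_(size G) -> R, p = \sum_(i < size G) a i * G`_i >]].

Lemma gen_memE p : reflect
  (exists a : 'I_(size G) -> R, p = \sum_(i < size G) a i * G`_i)
  (p \in gen_mem).
Proof. exact: asboolP. Qed.

Fact gen_mem0 : 0 \in gen_mem.
Proof. by apply/gen_memE; exists (fun=> 0); rewrite big1 // => i _; rewrite mul0r. Qed.

Fact gen_memP a : {in gen_mem &, forall p q, a * p + q \in gen_mem}.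
Proof.
move=> p q /gen_memE[b ->] /gen_memE[c ->]; apply/gen_memE.
exists (fun i => a * b i + c i); rewrite mulr_sumr -big_split /=.
by apply: eq_bigr => i _; rewrite mulrDl mulrA.
Qed.

Fact gen_mem_homog d : {in gen_mem, forall p, pihomog mdeg d p \in gen_mem}.
Proof.
have Dg p q : p \in gen_mem -> q \in gen_mem -> p + q \in gen_mem.
  by move=> hp hq; rewrite -[p]mul1r gen_memP.
have Ml a p : p \in gen_mem -> a * p \in gen_mem.
  by move=> hp; rewrite -[a * p]addr0 gen_memP ?gen_mem0.
have Gg (i : 'I_(size G)) : G`_i \in gen_mem.
  apply/gen_memE; exists (fun k => (k == i)%:R).
  rewrite (bigD1 i) //= eqxx mul1r big1 ?addr0 // => k /negPf->.
  by rewrite mul0r.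
have Sg (I : finType) (f : I -> R) :
    (forall i, f i \in gen_mem) -> \sum_i f i \in gen_mem.
  by move=> hf; apply: (big_ind (fun p => p \in gen_mem)) => //; exact: gen_mem0.
move=> _ /gen_memE[a ->]; rewrite linear_sum /=; apply: (Sg _ _) => i.
have /homogP[e he] : G`_i \is homog mdeg by apply: (allP homogG); exact: mem_nth.
rewrite (pihomog_partitionE (leqnn (mmeasure mdeg (a i)))) mulr_suml linear_sum /=.
apply: (Sg _ _) => k; have hk := dhomogM (pihomogP mdeg k (a i)) he.
case: (eqVneq (k + e)%N d) => [<-|ne]; first by rewrite pihomog_dE ?Ml.
by rewrite (pihomog_ne0 ne hk) gen_mem0.
Qed.

(* The ideal (g | g <- G). *)
Definition gen_ideal : hideal := HIdeal gen_mem0 gen_memP gen_mem_homog.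

End GeneratedIdeal.

Definition unit_ideal : hideal.
Proof. by exists predT. Defined.

Section ProductIdeal.

Variables I J : hideal.

Definition mul_mem : {pred R} := [pred p | `[< exists l : seq (R * R),
  all (fun ab => (ab.1 \in hmem I) && (ab.2 \in hmem J)) l /\
  p = \sum_(ab <- l) ab.1 * ab.2 >]].

Lemma mul_memE p : reflect
  (exists l : seq (R * R),
     all (fun ab => (ab.1 \in hmem I) && (ab.2 \in hmem J)) l /\
     p = \sum_(ab <- l) ab.1 * ab.2)
  (p \in mul_mem).
Proof. exact: asboolP. Qed.

Fact mul_mem0 : 0 \in mul_mem.
Proof. by apply/mul_memE; exists [::]; rewrite big_nil. Qed.

Fact mul_memP a : {in mul_mem &, forall p q, a * p + q \in mul_mem}.
Proof.
move=> p q /mul_memE[l [hl ->]] /mul_memE[m [hm ->]]; apply/mul_memE.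
exists ([seq (a * ab.1, ab.2) | ab <- l] ++ m); split.
  rewrite all_cat hm andbT all_map; apply: sub_all hl => ab /=.
  by move=> /andP[h1 h2]; rewrite h2 andbT; exact: hmemMl.
rewrite big_cat big_map mulr_sumr /=; congr (_ + _).
by apply: eq_bigr => ab _; rewrite mulrA.
Qed.

Fact mul_mem_homog d : {in mul_mem, forall p, pihomog mdeg d p \in mul_mem}.
Proof.
have Dg p q : p \in mul_mem -> q \in mul_mem -> p + q \in mul_mem.
  by move=> hp hq; rewrite -[p]mul1r mul_memP.
have Sg (T : finType) (f : T -> R) :
    (forall i, f i \in mul_mem) -> \sum_i f i \in mul_mem.
  by move=> hf; apply: (big_ind (fun p => p \in mul_mem)) => //; exact: mul_mem0.
move=> _ /mul_memE[l [hl ->]]; rewrite linear_sum /= big_seq.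
apply: (big_ind (fun p => p \in mul_mem)) => //; first exact: mul_mem0.
move=> [a b] /(allP hl)/andP[/= Ia Jb].
rewrite (pihomog_partitionE (leqnn (mmeasure mdeg a))) mulr_suml linear_sum /=.
apply: (Sg _ _) => i.
rewrite {1}(pihomog_partitionE (leqnn (mmeasure mdeg b))) mulr_sumr linear_sum /=.
apply: (Sg _ _) => j.
have hab := dhomogM (pihomogP mdeg i a) (pihomogP mdeg j b).
case: (eqVneq (i + j)%N d) => [<-|ne]; last by rewrite (pihomog_ne0 ne hab) mul_mem0.
rewrite pihomog_dE //; apply/mul_memE.
exists [:: (pihomog mdeg i a, pihomog mdeg j b)]; rewrite big_seq1 /= andbT.
by split=> //; apply/andP; split; exact: hmem_homog.
Qed.

Definition mul_ideal : hideal := HIdeal mul_mem0 mul_memP mul_mem_homog.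

End ProductIdeal.

Definition exp_ideal (I : hideal) (s : nat) : hideal :=
  iter s (mul_ideal I) unit_ideal.

End GradedAlgebra.

(* [power_series_quotient h N D] : \sum_m h m * t^m = N / D in Z[[t]], where D
   has constant coefficient 1 (hence is invertible) and N, D are polynomials. *)
Definition power_series_quotient (h : nat -> nat) (N D : {poly int}) : Prop :=
  D`_0 = 1 /\
  forall m : nat, \sum_(i < m.+1) (h i)%:Z * D`_(m - i) = N`_m.

Section Ideal.

Variable K : fieldType.
Local Notation x1 := ('X_0 : {mpoly K[3]}).
Local Notation x2 := ('X_1 : {mpoly K[3]}).
Local Notation x3 := ('X_2 : {mpoly K[3]}).

Definition edge_gens : seq {mpoly K[3]} := [:: x1 * x2; x1 * x3; x2 * x3].

Fact edge_gens_homog : all (fun g => g \is homog mdeg) edge_gens.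
Proof.
have hX (i j : 'I_3) : ('X_i * 'X_j : {mpoly K[3]}) \is homog mdeg.
  by apply/homogP; exists 2%N; apply: (@dhomogM _ _ mdeg 1 _ 1); rewrite dhomogX /= mdeg1.
by rewrite /= !hX.
Qed.

Definition edge_ideal : hideal K 3 := gen_ideal edge_gens_homog.

End Ideal.

(* 1 + 2 t + 3 t^2 + ... + 2 s t^(2 s - 1) - (C(s + 2, 2) - 2 s - 1) t^(2 s) *)
Definition hilbert_numerator (s : nat) : {poly int} :=
  \sum_(i < 2 * s) i.+1%:Z *: 'X^i
  - ('C(s + 2, 2)%:Z - (2 * s)%:Z - 1) *: 'X^(2 * s).

(* Main.v *)
(** Put g_i = x_0 x_1 x_2 / x_i. The ideal I is of linear type: its Rees algebra is
    S / (x_0 T_0 - x_2 T_2, x_1 T_1 - x_2 T_2), where S = R[T_0, T_1, T_2] and T_i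
    maps to g_i, and the two relations form a regular sequence. The part of
    T-degree s of their Koszul complex is therefore a free resolution of I^s; it is
    linear, hence minimal. Both exactness statements come from division in S by the
    relation x_i T_i - x_2 T_2, whose remainders have no monomial divisible by
    x_i T_i: distinct monomials x^u T^m with |m| = s that are remainders for both
    relations have distinct images under T = g, so evaluation is injective on them.

    Any two graded free resolutions of a module are homotopy equivalent, which
    reduces the uniqueness of the Betti numbers and the computation of Tor to this
    one resolution.

    Finally I^s is spanned by the monomials x^u with sum_i min(u_i, s) >= 2s. In
    degree d < 2s no monomial qualifies; in degree d >= 2s the monomials outside I^s
    are those with u_i + u_j < s for exactly one pair i, j, so there are
    3 * C(s + 1, 2) of them. *)

From HB Require Import structures.
Require Import Defs.
From mathcomp Require Import all_boot all_order all_algebra.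
From mathcomp Require Import zify.
From mathcomp Require Import boolp.
From mathcomp Require Import mpoly.

Set Implicit Arguments.
Unset Strict Implicit.
Unset Printing Implicit Defensive.

Import GRing.Theory.
Local Open Scope ring_scope.

(** * Comparison of graded free resolutions *)

Section PolyPart.
Variables (K : fieldType) (n : nat).
Local Notation R := {mpoly K[n]}.
Implicit Types (p q : R) (j : int).

Lemma poly_partN j p : poly_part j p -> poly_part j (- p).
Proof. by move=> hp; rewrite -sub0r; apply: poly_partB => //; exact: poly_part0. Qed.

Lemma poly_partD j p q : poly_part j p -> poly_part j q -> poly_part j (p + q).
Proof. by move=> hp hq; rewrite -[q]opprK; apply/poly_partB/poly_partN. Qed.

Lemma poly_part_sum j (I : Type) (r : seq I) (P : pred I) (c : I -> R) :
  (forall i, P i -> poly_part j (c i)) -> poly_part j (\sum_(i <- r | P i) c i).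
Proof.
move=> hc; apply: (big_ind (poly_part j)) => //; first exact: poly_part0.
exact: poly_partD.
Qed.

Lemma poly_part1 : poly_part 0 (1 : R).
Proof. exact: dhomog1. Qed.

Lemma poly_part_coef0 j p : poly_part j p -> p@_0%MM != 0 -> j = 0.
Proof.
case: j => d /=; last by move=> ->; rewrite mcoeff0 eqxx.
by move=> /dhomogP h; rewrite -mcoeff_msupp => /h /=; rewrite mdeg0 => <-.
Qed.

Lemma polyz_additive j : zmod_morphism (@polyz K n j).
Proof. by case: j => d p q /=; rewrite ?subr0 // raddfB. Qed.

HB.instance Definition _ j :=
  GRing.isZmodMorphism.Build R R (@polyz K n j) (polyz_additive j).

Lemma polyzM i j p q : poly_part i q -> polyz j (p * q) = polyz (j - i) p * q.
Proof.
move=> hq; have [s hs] := polyz_span p.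
rewrite {1}hs mulr_suml raddf_sum /= [in RHS]hs raddf_sum mulr_suml /=.
apply: eq_bigr => k _; rewrite (polyz_part _ (poly_partM (polyzP k p) hq)).
rewrite (polyz_part _ (polyzP k p)) -(inj_eq (addIr i) k) subrK.
by case: eqP => _; rewrite ?mul0r.
Qed.

Lemma polyz_eq0 p : (forall j, polyz j p = 0) -> p = 0.
Proof. by move=> h; have [s ->] := polyz_span p; rewrite big1. Qed.

Lemma polyz_support p : exists s : seq int, forall j, polyz j p != 0 -> j \in s.
Proof.
have [s hs] := polyz_span p; exists s => j; apply: contraNT => js.
rewrite hs raddf_sum big_seq big1 //= => i is_.
by rewrite (polyz_part _ (polyzP i p)); case: eqP js is_ => // -> /negP.
Qed.

Lemma polyz_cover p (s : seq int) : uniq s ->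
  (forall j, polyz j p != 0 -> j \in s) -> p = \sum_(j <- s) polyz j p.
Proof.
move=> us hs; apply/eqP; rewrite -subr_eq0; apply/eqP/polyz_eq0 => j.
rewrite raddfB /=; have [js|/negPf js] := boolP (j \in s).
  by rewrite (polyz_uniq_sum us (fun i => polyzP i p) js) subrr.
have [->|/hs] := eqVneq (polyz j p) 0; last by rewrite js.
rewrite sub0r raddf_sum big_seq big1 ?oppr0 //= => i is_.
by rewrite (polyz_part _ (polyzP i p)); case: eqP is_ js => // -> ->.
Qed.

End PolyPart.

(** * Degree-preserving matrices *)

Section GradedMatrix.
Variables (K : fieldType) (n : nat).
Local Notation R := {mpoly K[n]}.

(** With vectors as rows, [A] represents a degree-preserving map from the free module with shifts
    [a] to the one with shifts [b]. *)
Definition graded_mx p q (a : 'I_p -> int) (b : 'I_q -> int) (A : 'M[R]_(p, q)) :=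
  forall k l, poly_part (a k - b l) (A k l).

Definition graded_proj p q (a : 'I_p -> int) (b : 'I_q -> int) (A : 'M[R]_(p, q)) :=
  \matrix_(k, l) polyz (a k - b l) (A k l).

Section GradedMx.
Variables (p q r : nat) (a : 'I_p -> int) (b : 'I_q -> int) (c : 'I_r -> int).

Lemma graded_projP A : graded_mx a b (graded_proj a b A).
Proof. by move=> k l; rewrite mxE; exact: polyzP. Qed.

Lemma graded_proj_id A : graded_mx a b A -> graded_proj a b A = A.
Proof.
by move=> hA; apply/matrixP=> k l; rewrite mxE (polyz_part _ (hA k l)) eqxx.
Qed.

(** Multiplication by homogeneous entries translates degrees, so it commutes with taking components.
    Hence a lift chosen without regard to degrees can be replaced by its graded part. *)
Lemma graded_projM (A : 'M_(p, q)) (B : 'M_(q, r)) : graded_mx b c B ->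
  graded_proj a c (A *m B) = graded_proj a b A *m B.
Proof.
move=> hB; apply/matrixP=> k l; rewrite !mxE raddf_sum; apply: eq_bigr => m _ /=.
by rewrite !mxE (polyzM _ _ (hB m l)) opprB addrA subrK.
Qed.

Lemma graded_mxM (A : 'M_(p, q)) (B : 'M_(q, r)) :
  graded_mx a b A -> graded_mx b c B -> graded_mx a c (A *m B).
Proof.
move=> hA hB; rewrite -[A]graded_proj_id // -graded_projM //.
by move=> k l; rewrite mxE; exact: polyzP.
Qed.

Lemma graded_mxB (A B : 'M_(p, q)) :
  graded_mx a b A -> graded_mx a b B -> graded_mx a b (A - B).
Proof. by move=> hA hB k l; rewrite !mxE; exact: poly_partB. Qed.

Lemma graded_mx1 : graded_mx a a 1%:M.
Proof.
move=> k l; rewrite mxE; case: eqP => [->|_]; last exact: poly_part0.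
by rewrite subrr; exact: poly_part1.
Qed.

End GradedMx.
End GradedMatrix.

(** * Lifting through a resolution, chain maps and homotopies *)

Section Resolution.
Variables (K : fieldType) (n : nat) (M : grmod K n).
Local Notation R := {mpoly K[n]}.

Section OneResolution.
Variables (G : grfree K n) (eps : {linear 'rV[R]_(grank G 0) -> M}).
Hypothesis resG : augmented_resolution eps.

(** The augmentation serves as the differential out of degree 0, so that both exactness conditions
    of a resolution read alike. *)
Definition cycle i : 'rV[R]_(grank G i) -> Prop :=
  match i with
  | 0 => fun v => eps v = 0
  | i'.+1 => fun v => v *m gdiff G i' = 0
  end.

Lemma cycleP i (v : 'rV_(grank G i)) :
  cycle v <-> exists w, v = w *m gdiff G i.
Proof. by case: resG v => _ _ _ h0 hS; case: i => [|i] v; [exact: h0|exact: hS]. Qed.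

Lemma gdiff_graded i : graded_mx (@gshift _ _ G i.+1) (@gshift _ _ G i) (gdiff G i).
Proof.
case: resG => h _ _ _ _ k l.
(* Rows of the matrix are images of basis vectors, and the [k]-th basis vector is homogeneous of
   degree [gshift k]. *)
have /h : free_part (gshift k) (delta_mx 0 k : 'rV[R]_(grank G i.+1)).
  move=> m; rewrite mxE eqxx /=; case: eqP => [->|_]; last exact: poly_part0.
  by rewrite subrr; exact: poly_part1.
by rewrite -rowE => /(_ l); rewrite mxE.
Qed.

Lemma gdiff_gdiff i : gdiff G i.+1 *m gdiff G i = 0.
Proof.
apply/row_matrixP => k; rewrite row_mul row0.
by case: resG => _ _ _ _ h; apply/h; exists (delta_mx 0 k); rewrite rowE.
Qed.

Lemma lift_cycles i p (a : 'I_p -> int) (A : 'M[R]_(p, grank G i)) :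
  graded_mx a (@gshift _ _ G i) A -> (forall k, cycle (row k A)) ->
  exists2 B, graded_mx a (@gshift _ _ G i.+1) B & A = B *m gdiff G i.
Proof.
move=> hA cA.
have /choice[w hw] : forall k, exists w, row k A = w *m gdiff G i.
  by move=> k; apply/cycleP.
exists (graded_proj a (@gshift _ _ G i.+1) (\matrix_k w k)).
  exact: graded_projP.
rewrite -(graded_projM _ _ (@gdiff_graded i)).
rewrite -[LHS](graded_proj_id hA); congr graded_proj.
by apply/row_matrixP => k; rewrite row_mul rowK hw.
Qed.

Lemma eps_free_part j (v : 'rV[R]_(grank G 0)) : free_part j v -> part j (eps v).
Proof. by case: resG => _ h _ _ _; exact: h. Qed.

(** An arbitrary preimage of [x k] is split into homogeneous components; directness of the grading
    of [M] forces the component of degree [a k] to be a preimage by itself. *)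
Lemma lift_augmentation p (a : 'I_p -> int) (x : 'I_p -> M) :
  (forall k, part (a k) (x k)) ->
  exists2 B : 'M_(p, grank G 0), graded_mx a (@gshift _ _ G 0) B &
    forall k, eps (row k B) = x k.
Proof.
move=> hx; have /choice[w hw] : forall k, exists w, eps w = x k.
  by case: resG => _ _ h _ _ k; exact: h.
exists (graded_proj a (@gshift _ _ G 0) (\matrix_k w k)); first exact: graded_projP.
move=> k; pose c j : 'rV[R]_(grank G 0) := \row_l polyz (j - gshift l) (w k 0 l).
have -> : row k (graded_proj a (@gshift _ _ G 0) (\matrix_k w k)) = c (a k).
  by apply/rowP => l; rewrite !mxE.
have hc j : free_part j (c j) by move=> l; rewrite mxE; exact: polyzP.
have [s us [sk hs]] : exists2 s, uniq s & a k \in s /\ w k = \sum_(j <- s) c j.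
  have /choice[t ht] := fun l => polyz_support (w k 0 l).
  (* Degree [i] in entry [l] is degree [i + gshift l] in the free module. Including [a k] allows
     directness to be applied in that degree. *)
  pose s0 := a k :: flatten [seq [seq i + gshift l | i <- t l] | l <- enum 'I_(grank G 0)].
  exists (undup s0); rewrite ?undup_uniq // mem_undup mem_head; split => //.
  apply/rowP => l; rewrite summxE.
  have us : uniq [seq j - gshift l | j <- undup s0].
    by rewrite map_inj_uniq ?undup_uniq //; exact: addIr.
  rewrite {1}(polyz_cover (p := w k 0 l) us) => [|j /ht hj].
    by rewrite big_map; apply: eq_bigr => j _; rewrite mxE.
  apply/mapP; exists (j + gshift l); last by rewrite addrK.
  rewrite mem_undup inE; apply/orP; right; apply/flattenP.
  by exists [seq i + gshift l | i <- t l]; apply: map_f; rewrite ?mem_enum.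
have /= := @part_direct _ _ M s (fun j => eps (c j) - (if j == a k then x k else 0)) us.
have -> : \sum_(j <- s) (eps (c j) - (if j == a k then x k else 0)) = 0.
  rewrite sumrB -raddf_sum -hs -big_mkcond /= -big_filter.
  by rewrite filter_pred1_uniq // big_seq1 hw subrr.
move=> /(_ _ erefl (a k) sk); rewrite eqxx => h; apply/eqP; rewrite -subr_eq0.
apply/eqP/h => j; apply: partB; first exact: eps_free_part.
by case: eqP => [->//|_]; exact: part0.
Qed.

(* The part [d h] of a null homotopy [d h + h d] that factors through degree
   [i - 1]. *)
Definition nullhomotopic_below i : 'M[R]_(grank G i) -> Prop :=
  match i with
  | 0 => fun X => X = 0
  | i'.+1 => fun X => exists a, X = gdiff G i' *m a
  end.

Lemma nullhomotopic_below_diff i X :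
  nullhomotopic_below X -> gdiff G i *m X = 0.
Proof.
case: i X => [|i] X /=; first by move=> ->; rewrite mulmx0.
by case=> a ->; rewrite mulmxA gdiff_gdiff mul0mx.
Qed.

Lemma homotopy0 (X : 'M[R]_(grank G 0)) :
  graded_mx (@gshift _ _ G 0) (@gshift _ _ G 0) X ->
  (forall v, eps (v *m X) = 0) ->
  exists2 h, graded_mx (@gshift _ _ G 0) (@gshift _ _ G 1) h &
    nullhomotopic_below (X - h *m gdiff G 0).
Proof.
move=> gX eX; have [|h gh hX] := lift_cycles gX.
  by move=> k /=; rewrite -[X]mul1mx row_mul.
by exists h => //=; rewrite -hX subrr.
Qed.

(** Writing d for the differential, (Y - d h) d = d (X - h d) = 0, so Y - d h lifts as h' d; then Y
    - h' d = d h factors through the degree below. *)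
Lemma homotopyS i X Y h :
  graded_mx (@gshift _ _ G i.+1) (@gshift _ _ G i.+1) Y ->
  graded_mx (@gshift _ _ G i) (@gshift _ _ G i.+1) h ->
  Y *m gdiff G i = gdiff G i *m X -> nullhomotopic_below (X - h *m gdiff G i) ->
  exists2 h', graded_mx (@gshift _ _ G i.+1) (@gshift _ _ G i.+2) h' &
    nullhomotopic_below (Y - h' *m gdiff G i.+1).
Proof.
move=> gY gh YX hX; pose Z := Y - gdiff G i *m h.
have gZ : graded_mx (@gshift _ _ G i.+1) (@gshift _ _ G i.+1) Z.
  by apply: graded_mxB => //; apply: graded_mxM gh; exact: gdiff_graded.
have [|h' gh' hZ] := lift_cycles gZ.
  move=> k /=; rewrite -row_mul mulmxBl YX -mulmxA -mulmxBr.
  by rewrite nullhomotopic_below_diff // row0.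
by exists h' => //=; exists h; rewrite -hZ opprB addrCA subrr addr0.
Qed.

End OneResolution.

Section Comparison.
Variables (F G : grfree K n).
Variables (eF : {linear 'rV[R]_(grank F 0) -> M}) (eG : {linear 'rV[R]_(grank G 0) -> M}).
Hypotheses (resF : augmented_resolution eF) (resG : augmented_resolution eG).

Lemma chain_map0 : exists2 f : 'M[R]_(grank F 0, grank G 0),
  graded_mx (@gshift _ _ F 0) (@gshift _ _ G 0) f & forall v, eG (v *m f) = eF v.
Proof.
have [|f gf hf] := lift_augmentation resG (a := @gshift _ _ F 0)
    (x := fun k => eF (delta_mx 0 k)).
  move=> k; apply: eps_free_part => // l; rewrite mxE eqxx /=.
  case: eqP => [->|_]; last exact: poly_part0.
  by rewrite subrr; exact: poly_part1.
exists f => // v; rewrite [v in RHS]row_sum_delta mulmx_sum_row !raddf_sum.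
by apply: eq_bigr => k _ /=; rewrite !linearZ hf.
Qed.

(** The induction invariant for chain maps: it follows from compatibility with the augmentations in
    degree 0, and with the differentials afterwards. *)
Definition preserves_cycles i (f : 'M[R]_(grank F i, grank G i)) :=
  forall v, cycle eF v -> cycle eG (v *m f).

Lemma chain_mapS i f : graded_mx (@gshift _ _ F i) (@gshift _ _ G i) f ->
  preserves_cycles f ->
  exists f', [/\ graded_mx (@gshift _ _ F i.+1) (@gshift _ _ G i.+1) f',
    gdiff F i *m f = f' *m gdiff G i & preserves_cycles f'].
Proof.
move=> gf cf; have [||f' gf' hf'] := @lift_cycles _ _ resG i _ (@gshift _ _ F i.+1)
  (gdiff F i *m f).
- by apply: graded_mxM gf; exact: gdiff_graded resF _.
- move=> k; rewrite row_mul; apply: cf; apply/(cycleP resF).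
  by exists (delta_mx 0 k); rewrite rowE.
exists f'; split=> // v /= hv.
by rewrite -mulmxA -hf' mulmxA hv mul0mx.
Qed.

End Comparison.

Section Equivalence.
Variables (F G : grfree K n).
Hypotheses (resF : graded_resolution F M) (resG : graded_resolution G M).

(** Only one homological degree at a time is asserted, since Betti numbers and Tor are read off
    degree by degree. *)
Lemma homotopy_equivalence i :
  exists (f : 'M[R]_(grank F i, grank G i)) (g : 'M[R]_(grank G i, grank F i))
         (hF : 'M[R]_(grank F i, grank F i.+1)) (hG : 'M[R]_(grank G i, grank G i.+1)),
  [/\ graded_mx (@gshift _ _ F i) (@gshift _ _ G i) f,
      graded_mx (@gshift _ _ F i) (@gshift _ _ F i.+1) hF,
      nullhomotopic_below (f *m g - 1%:M - hF *m gdiff F i)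
    & nullhomotopic_below (g *m f - 1%:M - hG *m gdiff G i)].
Proof.
case: resF resG => [eF rF] [eG rG].
(* The induction also carries the grading of all four matrices and the preservation of cycles, which
   the next lifts require. *)
suff: exists (f : 'M[R]_(grank F i, grank G i)) (g : 'M[R]_(grank G i, grank F i))
         (hF : 'M[R]_(grank F i, grank F i.+1)) (hG : 'M[R]_(grank G i, grank G i.+1)),
  [/\ [/\ graded_mx (@gshift _ _ F i) (@gshift _ _ G i) f,
      graded_mx (@gshift _ _ G i) (@gshift _ _ F i) g,
      graded_mx (@gshift _ _ F i) (@gshift _ _ F i.+1) hF
    & graded_mx (@gshift _ _ G i) (@gshift _ _ G i.+1) hG],
      preserves_cycles eF eG f, preserves_cycles eG eF g,
      nullhomotopic_below (f *m g - 1%:M - hF *m gdiff F i)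
    & nullhomotopic_below (g *m f - 1%:M - hG *m gdiff G i)].
  by move=> [f [g [hF [hG [[? ? ? ?] _ _ ? ?]]]]]; exists f, g, hF, hG.
have gr1 (H : grfree K n) k p (a : 'I_p -> int)
      (u : 'M[R]_(grank H k, p)) (v : 'M[R]_(p, grank H k)) :
    graded_mx (@gshift _ _ H k) a u -> graded_mx a (@gshift _ _ H k) v ->
    graded_mx (@gshift _ _ H k) (@gshift _ _ H k) (u *m v - 1%:M).
  by move=> gu gv; apply: graded_mxB; [exact: graded_mxM gu gv | exact: graded_mx1].
elim: i => [|i [f [g [hF [hG [[gf gg ghF ghG] cf cg nF nG]]]]]].
  have [f gf ef] := chain_map0 rF rG; have [g gg eg] := chain_map0 rG rF.
  have [|hF ghF nF] := homotopy0 rF (gr1 _ _ _ _ _ _ gf gg).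
    by move=> v; rewrite mulmxBr mulmx1 mulmxA raddfB /= eg ef subrr.
  have [|hG ghG nG] := homotopy0 rG (gr1 _ _ _ _ _ _ gg gf).
    by move=> v; rewrite mulmxBr mulmx1 mulmxA raddfB /= ef eg subrr.
  exists f, g, hF, hG; split=> // v /=; first by rewrite ef.
  by rewrite eg.
have [f' [gf' df cf']] := chain_mapS rF rG gf cf.
have [g' [gg' dg cg']] := chain_mapS rG rF gg cg.
have [|hF' ghF' nF'] := homotopyS rF (gr1 _ _ _ _ _ _ gf' gg') ghF _ nF.
  by rewrite mulmxBl mulmxBr mul1mx mulmx1 -mulmxA -dg mulmxA -df mulmxA.
have [|hG' ghG' nG'] := homotopyS rG (gr1 _ _ _ _ _ _ gg' gf') ghG _ nG.
  by rewrite mulmxBl mulmxBr mul1mx mulmx1 -mulmxA -df mulmxA -dg mulmxA.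
by exists f', g', hF', hG'.
Qed.

Local Notation red := (map_mx (@mcoeff n K 0%MM)).

(** A homogeneous entry with nonzero constant term has degree 0. *)
Lemma graded_red p q (a : 'I_p -> int) (b : 'I_q -> int) (A : 'M[R]_(p, q)) k l :
  graded_mx a b A -> red A k l != 0 -> a k = b l.
Proof.
move=> gA; rewrite mxE => /(poly_part_coef0 (gA k l)) /eqP.
by rewrite subr_eq0 => /eqP.
Qed.

Lemma minimal_tensor_diff (H : grfree K n) i : minimal H -> tensor_diff H i = 0.
Proof. by move=> mH; apply/matrixP => k l; rewrite !mxE mH. Qed.

Lemma minimal_nullhomotopic (H : grfree K n) i (X : 'M[R]_(grank H i)) :
  minimal H -> nullhomotopic_below X -> red X = 0.
Proof.
move=> mH; case: i X => [|i] X /=; first by move=> ->; rewrite raddf0.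
by case=> a ->; rewrite map_mxM -/(tensor_diff H i) minimal_tensor_diff ?mul0mx.
Qed.

(** Each nonzero homotopy term has a differential as a factor and so vanishes modulo the variables;
    a homotopy inverse becomes a one-sided inverse over [K]. *)
Lemma minimal_homotopy (H : grfree K n) i p (u : 'M[R]_(grank H i, p)) v h :
  minimal H -> nullhomotopic_below (u *m v - 1%:M - h *m gdiff H i) ->
  red u *m red v = 1%:M.
Proof.
move=> mH /(minimal_nullhomotopic mH); rewrite !raddfB /= !map_mxM map_mx1.
rewrite -/(tensor_diff H i) minimal_tensor_diff // mulmx0 subr0.
by move/eqP; rewrite subr_eq0 => /eqP.
Qed.

(** Modulo the variables the comparison maps are mutually inverse matrices over [K], which gives
    equal ranks; a nonzero entry in row [k] joins generators of equal degree. *)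
Lemma minimal_has_form l : minimal F -> minimal G -> has_form G l -> has_form F l.
Proof.
move=> mF mG hG i; case: (hG i) => rG sG.
have [f [g [hF [hG' [gf _ nF nG]]]]] := homotopy_equivalence i.
have fg := minimal_homotopy mF nF; have gf1 := minimal_homotopy mG nG.
split.
  by rewrite -rG; apply/anti_leq; rewrite (mulmx1_min fg) (mulmx1_min gf1).
move=> k; have [l' hl] : exists l', red f k l' != 0.
  apply/existsP; apply: contraT; rewrite negb_exists => /forallP h.
  move/matrixP/(_ k k): fg; rewrite !mxE eqxx big1 => [/eqP|l' _].
    by rewrite eq_sym oner_eq0.
  by move/eqP: (negbNE (h l')) => ->; rewrite mul0r.
by rewrite (graded_red gf hl).
Qed.

(** If the comparison map killed [v] modulo the variables, the homotopy would make [v] a boundary.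
    So the image of [v] has a nonzero coordinate, and it sits at a generator of [G] of degree
    [j]. *)
Lemma Tor_of_minimal i j (v : 'rV[K]_(grank F i)) : minimal G ->
  tensor_part j v -> tensor_cycle v -> ~ tensor_boundary j v ->
  exists k, @gshift _ _ G i k = j.
Proof.
move=> mG pv cv nbv.
have [f [g [hF [_ [gf gh nF _]]]]] := homotopy_equivalence i.
have [l hl] : exists l, (v *m red f) 0 l != 0.
  apply/existsP; apply: contra_notT nbv; rewrite negb_exists => /forallP h.
  have vf : v *m red f = 0.
    by apply/rowP => l; rewrite [RHS]mxE; apply/eqP/negbNE.
  (* The nullhomotopic remainder is zero in degree 0 and otherwise begins with the differential,
     which kills the cycle [v]. *)
  have vX : v *m red (f *m g - 1%:M - hF *m gdiff F i) = 0.
    case: (i) f g hF nF v cv {pv vf gf gh h} => [|i'] f g hF nF v cv.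
      by rewrite /= in nF; rewrite nF raddf0 mulmx0.
    by case: nF => a ->; rewrite map_mxM mulmxA cv mul0mx.
  exists (- (v *m red hF)); split.
    move=> k; rewrite !mxE oppr_eq0 => nz.
    have [l /= nzl] : exists l, v 0 l * red hF l k != 0.
      apply/existsP; apply: contraNT nz; rewrite negb_exists => /forallP h'.
      by rewrite big1 // => l _; apply/eqP/negbNE.
    move: nzl; rewrite mulf_eq0 negb_or => /andP[vl hlk].
    by rewrite -(graded_red gh hlk) (pv _ vl).
  move: vX; rewrite !raddfB /= !map_mxM map_mx1 mulmx1 !mulmxA.
  rewrite vf mul0mx.
  rewrite sub0r -opprD => /eqP; rewrite oppr_eq0 addrC addr_eq0 => /eqP h'.
  by rewrite mulNmx [X in - X]h' opprK.
move: hl; rewrite mxE => nz.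
have [k /= nzk] : exists k, v 0 k * red f k l != 0.
  apply/existsP; apply: contraNT nz; rewrite negb_exists => /forallP h'.
  by rewrite big1 // => k _; apply/eqP/negbNE.
move: nzk; rewrite mulf_eq0 negb_or => /andP[vk fkl].
by exists l; rewrite -(graded_red gf fkl) (pv _ vk).
Qed.

End Equivalence.
End Resolution.

(** * Division by the relations of the Rees algebra *)

Lemma mcoeffXM (A : comNzRingType) n (p : {mpoly A[n]}) (k m : 'X_{1..n}) :
  ('X_[k] * p)@_m = if (k <= m)%MM then p@_(m - k) else 0.
Proof.
rewrite mulrC; case: ifP => [/submK {1}<-|/negP km].
  by rewrite addmC mcoeffMX.
apply: memN_msupp_eq0; rewrite (perm_mem (msuppMX p k)).
by apply/mapP => -[m' _ def_m]; apply: km; rewrite def_m lem_addr.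
Qed.

Lemma syzygy_rearrange (A : comNzRingType) (f g c r q : A) :
  f * (g * c + r) + g * q = 0 -> g * (f * c + q) = - (f * r).
Proof.
by move=> E; apply/eqP; rewrite -addr_eq0 -E !mulrDr (mulrCA g) addrAC.
Qed.

Section KoszulRelations.
Variable K : fieldType.
Local Notation R := {mpoly K[3]}.
Local Notation S := {mpoly R[3]}.
Local Notation z := (ord_max : 'I_3).
Implicit Types (p q r : S) (i j : 'I_3) (m u : 'X_{1..3}).

(** This is x_i T_i: the x are the variables of the coefficient ring and the T the outer ones. *)
Definition diag_var i : S := ('X_i : R) *: ('X_i : S).

Definition koszul_rel i : S := diag_var i - diag_var z.

Lemma mcoeff_diag_var i p m :
  (diag_var i * p)@_m = 'X_i * if (U_(i) <= m)%MM then p@_(m - U_(i)) else 0.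
Proof. by rewrite /diag_var -scalerAl mcoeffZ (mcoeffXM p). Qed.

(** The guard rules out truncation in the subtraction of exponents. *)
Definition diag_coef i p m u : K :=
  if (0 < m i)%N && (0 < u i)%N then (p@_(m - U_(i)))@_(u - U_(i)) else 0.

Lemma coef_diag_var i p m u : ((diag_var i * p)@_m)@_u = diag_coef i p m u.
Proof.
rewrite mcoeff_diag_var lep1mP -lt0n /diag_coef.
by case: ifP => _; rewrite ?mulr0 ?mcoeff0 // mcoeffXM lep1mP -lt0n.
Qed.

Lemma coef_koszul_rel i p m u :
  ((koszul_rel i * p)@_m)@_u = diag_coef i p m u - diag_coef z p m u.
Proof. by rewrite mulrBl !mcoeffB; congr (_ - _); exact: coef_diag_var. Qed.

Lemma diag_coef_neq0 i p m u :
  diag_coef i p m u != 0 -> (p@_(m - U_(i)))@_(u - U_(i)) != 0.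
Proof. by rewrite /diag_coef; case: ifP => // _; rewrite eqxx. Qed.

Lemma diag_coefD i p m u : diag_coef i p (m + U_(i)) (u + U_(i)) = (p@_m)@_u.
Proof. by rewrite /diag_coef !mnmDE !mnm1E eqxx !addn1 !addmK. Qed.

(* Homogeneous of degree [s - k] in the outer variables; the additive form makes
   [0] the only such polynomial when [s < k]. *)
Definition tdeg s k p := forall m, p@_m != 0 -> (mdeg m + k = s)%N.

Lemma tdeg0 s k : tdeg s k 0.
Proof. by move=> m; rewrite mcoeff0 eqxx. Qed.

Lemma tdegD s k p q : tdeg s k p -> tdeg s k q -> tdeg s k (p + q).
Proof.
move=> hp hq m; rewrite mcoeffD; have [->|/hp //] := eqVneq p@_m 0.
by rewrite add0r => /hq.
Qed.

Lemma tdegN s k p : tdeg s k p -> tdeg s k (- p).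
Proof. by move=> hp m; rewrite mcoeffN oppr_eq0 => /hp. Qed.

Lemma tdegZX s k a m : (mdeg m + k = s)%N -> tdeg s k (a *: 'X_[m]).
Proof.
move=> hm m'; rewrite mcoeffZ mcoeffX; have [<-//|_] := eqVneq m m'.
by rewrite mulr0 eqxx.
Qed.

Lemma tdeg_diag_var s k i p : tdeg s k.+1 p -> tdeg s k (diag_var i * p).
Proof.
move=> hp m; rewrite mcoeff_diag_var.
case: ifP => [le_im|_]; last by rewrite mulr0 eqxx.
have [->|/hp <- _] := eqVneq (p@_(m - U_(i))) 0; first by rewrite mulr0 eqxx.
by rewrite -{1}(submK le_im) mdegD mdeg1 addn1 addSnnS.
Qed.

Lemma tdeg_koszul_rel s k i p : tdeg s k.+1 p -> tdeg s k (koszul_rel i * p).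
Proof.
move=> hp; rewrite mulrBl; apply: tdegD; first exact: tdeg_diag_var.
by apply/tdegN/tdeg_diag_var.
Qed.

(** The remainders of division by [koszul_rel i], with x_i T_i taken as its leading monomial. *)
Definition normal i p :=
  forall m u, (p@_m)@_u != 0 -> (m i == 0)%N || (u i == 0)%N.

Lemma normal0 i : normal i 0.
Proof. by move=> m u; rewrite !mcoeff0 eqxx. Qed.

Lemma normalD i p q : normal i p -> normal i q -> normal i (p + q).
Proof.
move=> hp hq m u; rewrite !mcoeffD; have [->|/hp //] := eqVneq (p@_m)@_u 0.
by rewrite add0r => /hq.
Qed.

Lemma normalN i p : normal i p -> normal i (- p).
Proof. by move=> hp m u; rewrite !mcoeffN oppr_eq0 => /hp. Qed.

Definition term (c : K) u m : S := (c *: 'X_[u]) *: 'X_[m].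

Lemma coef_term c u m m' u' :
  ((term c u m)@_m')@_u' = c * ((m == m') && (u == u'))%:R.
Proof.
rewrite mcoeffZ mcoeffX; case: eqP => _; last by rewrite !mulr0 mcoeff0.
by rewrite mulr1 mcoeffZ mcoeffX.
Qed.

Lemma normal_term i c u m : (m i == 0)%N || (u i == 0)%N -> normal i (term c u m).
Proof.
move=> h m' u'; rewrite coef_term.
have [<-|_] := eqVneq m m'; last by rewrite mulr0 eqxx.
by have [<-//|_] := eqVneq u u'; rewrite mulr0 eqxx.
Qed.

Lemma mul_diag_var_term i c u m :
  diag_var i * term c u m = term c (U_(i) + u) (U_(i) + m).
Proof. by rewrite /term !mpolyXD /diag_var -scalerAl -scalerAr scalerA -scalerAr. Qed.

Lemma term_sum p :
  p = \sum_(m <- msupp p) \sum_(u <- msupp p@_m) term (p@_m)@_u u m.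
Proof.
rewrite {1}[p]mpolyE; apply: eq_bigr => m _.
by rewrite {1}[p@_m]mpolyE scaler_suml.
Qed.

(** Replacing x_i T_i by x_2 T_2 lowers the exponent of x_i, so the rewriting ends. Exponents at the
    third index [j] do not change, hence normality there persists. *)
Lemma division_term s k i c m u : i != z -> (mdeg m + k = s)%N ->
  exists q r, [/\ tdeg s k.+1 q, tdeg s k r, normal i r,
    forall j, j != i -> j != z -> (m j == 0)%N || (u j == 0)%N -> normal j r
  & term c u m = koszul_rel i * q + r].
Proof.
move=> iz; have [n] := ubnP (u i); elim: n => // n IH in m u * => lt_u hm.
have [h|] := boolP ((m i == 0)%N || (u i == 0)%N).
  exists 0, (term c u m); split; rewrite ?mulr0 ?add0r //.
  - exact: tdeg0.
  - exact: tdegZX.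
  - exact: normal_term.
  - by move=> j _ _ hj; apply: normal_term.
rewrite negb_or -!lep1mP => /andP[im iu].
pose m' := (m - U_(i))%MM; pose u' := (u - U_(i))%MM.
have Em : m = (U_(i) + m')%MM by rewrite addmC submK.
have Eu : u = (U_(i) + u')%MM by rewrite addmC submK.
have hm' : (mdeg m' + k.+1 = s)%N by rewrite -hm Em mdegD mdeg1 addnS.
have [||q [r [hq hr nr nj E]]] := IH (U_(z) + m')%MM (U_(z) + u')%MM.
- rewrite mnmDE mnm1E eq_sym (negPf iz).
  by move: lt_u; rewrite Eu mnmDE mnm1E eqxx.
- by rewrite mdegD mdeg1 -hm'; lia.
(* One rewriting step writes x_i T_i as the relation plus x_2 T_2; its cofactor [term c u' m'] joins
   the quotient. *)
exists (q + term c u' m'), r; split=> //.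
- by apply: tdegD => //; apply: tdegZX.
- move=> j ji jz hj; apply: nj => //; move: hj.
  by rewrite Em Eu !mnmDE !mnm1E ![_ == j]eq_sym (negPf ji) (negPf jz).
rewrite {1}Em {1}Eu -mul_diag_var_term mulrDr addrAC -E -mul_diag_var_term.
by rewrite -mulrDl addrC subrK.
Qed.

(** The clause on [j] lets a second division keep the normality achieved by the first. *)
Lemma division s k i p : i != z -> tdeg s k p ->
  exists q r, [/\ tdeg s k.+1 q, tdeg s k r, normal i r,
    forall j, j != i -> j != z -> normal j p -> normal j r
  & p = koszul_rel i * q + r].
Proof.
move=> iz hp; pose P x := exists q r, [/\ tdeg s k.+1 q, tdeg s k r, normal i r,
    forall j, j != i -> j != z -> normal j p -> normal j r
  & x = koszul_rel i * q + r].
have P0 : P 0.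
  exists 0, 0; rewrite mulr0 addr0; split=> //; try exact: tdeg0.
  - exact: normal0.
  - by move=> *; exact: normal0.
have PD x y : P x -> P y -> P (x + y).
  move=> [q [r [q1 r1 n1 j1 ->]]] [q' [r' [q2 r2 n2 j2 ->]]].
  exists (q + q'), (r + r'); rewrite mulrDr addrACA; split=> //; try exact: tdegD.
  - exact: normalD.
  - by move=> j ji jz nj; apply: normalD; [exact: j1|exact: j2].
suff : P p by [].
rewrite [p]term_sum big_seq; apply: (big_ind P) => // m; rewrite mcoeff_msupp => pm.
rewrite big_seq; apply: (big_ind P) => // u; rewrite mcoeff_msupp => pmu.
have [q [r [hq hr nr nj E]]] := division_term ((p@_m)@_u) u iz (hp _ pm).
by exists q, r; split=> // j ji jz /(_ _ _ pmu); apply: nj.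
Qed.

(** Uniqueness of remainders. At a position divisible by x_i T_i the product has coefficient 0,
    which equates a coefficient of [p] with 0 or with one of smaller exponent in x_2; descent on
    that exponent concludes. *)
Lemma koszul_rel_normal_eq0 i p : i != z -> normal i (koszul_rel i * p) -> p = 0.
Proof.
move=> iz np; apply/mpolyP => m; apply/mpolyP => u; rewrite !mcoeff0.
have [n] := ubnP (u z); elim: n => // n IH in m u * => lt_u.
have: ((koszul_rel i * p)@_(m + U_(i)))@_(u + U_(i)) = 0.
  apply/eqP; apply: contraT => /np; rewrite !mnmDE !mnm1E eqxx.
  by rewrite !addn1.
rewrite coef_koszul_rel => /eqP; rewrite subr_eq0 => /eqP E.
have {}E := etrans (esym (diag_coefD i p m u)) E.
apply/eqP; rewrite {}E; apply: contraT => nz.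
have uz : (0 < u z)%N.
  move: nz; rewrite /diag_coef; case: ifP => [/andP[_]|_]; last by rewrite eqxx.
  by rewrite mnmDE mnm1E (negPf iz) addn0.
move/diag_coef_neq0: nz; rewrite IH ?eqxx // mnmBE mnmDE !mnm1E eqxx (negPf iz).
by rewrite addn0; move: lt_u uz; rewrite ltnS; lia.
Qed.

Lemma normal_mul_koszul_rel i j p : j != i -> i != z ->
  normal i p -> normal i (koszul_rel j * p).
Proof.
move=> ji iz np m u; rewrite coef_koszul_rel => h.
have nz (x y : K) : x - y != 0 -> x != 0 \/ y != 0.
  by have [->|] := eqVneq x 0; [rewrite sub0r oppr_eq0; right|left].
suff [l li /np] : exists2 l, l != i & (p@_(m - U_(l)))@_(u - U_(l)) != 0.
  by rewrite !mnmBE !mnm1E (negPf li) !subn0.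
case: (nz _ _ h) => /diag_coef_neq0; first by exists j.
by exists z; rewrite // eq_sym.
Qed.

Lemma koszul_rel_inj i p : i != z -> koszul_rel i * p = 0 -> p = 0.
Proof.
by move=> iz h; apply: (koszul_rel_normal_eq0 iz); rewrite h; exact: normal0.
Qed.

(** Regularity of the sequence. With f and g the relations of [i] and [j], divide p = g c + r. Then
    g (f c + q) = - f r is normal at [j], so f c + q = 0, and injectivity of f gives r = 0. *)
Lemma koszul_exact s k i j p q : i != j -> i != z -> j != z -> tdeg s k p ->
  koszul_rel i * p + koszul_rel j * q = 0 ->
  exists c, [/\ tdeg s k.+1 c, p = koszul_rel j * c & q = - (koszul_rel i * c)].
Proof.
move=> ij iz jz hp; have [c [r [hc _ nr _ ->]]] := division jz hp.
move=> /syzygy_rearrange E'.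
have q0 : koszul_rel i * c + q = 0.
  apply: (koszul_rel_normal_eq0 jz); rewrite E'; apply: normalN.
  exact: normal_mul_koszul_rel.
have r0 : r = 0.
  by apply: (koszul_rel_inj iz); apply/eqP; rewrite -oppr_eq0 -E' q0 mulr0.
exists c; rewrite r0 addr0; split=> //.
by apply/eqP; rewrite -addr_eq0 addrC q0.
Qed.

End KoszulRelations.

(** * Powers of the edge ideal *)

Lemma ord3P (i : 'I_3) : [\/ i = 0, i = 1 | i = ord_max].
Proof.
by case: i => -[|[|[|//]]] h; [constructor 1|constructor 2|constructor 3]; apply: val_inj.
Qed.

Lemma mdeg3 (m : 'X_{1..3}) : mdeg m = (m 0%R + m 1%R + m ord_max)%N.
Proof.
rewrite mdegE 3!big_ord_recl big_ord0 addn0 addnA.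
by congr (m _ + m _ + m _)%N; apply: val_inj.
Qed.

Lemma mnm3P (m m' : 'X_{1..3}) :
  m 0%R = m' 0%R -> m 1%R = m' 1%R -> m ord_max = m' ord_max -> m = m'.
Proof. by move=> h0 h1 h2; apply/mnmP => i; case: (ord3P i) => ->. Qed.

Section EdgeIdealPowers.
Variable K : fieldType.
Local Notation R := {mpoly K[3]}.
Local Notation S := {mpoly R[3]}.
Local Notation z := (ord_max : 'I_3).
Implicit Types (P Q : S) (p q : R) (i j : 'I_3) (m u : 'X_{1..3}).

(* [edge_gen i] is the product of the variables other than ['X_i], so the power
   product of the [edge_gen i] of exponent [m], with [mdeg m = s], is
   ['X_[mnm_compl s m]]. *)
Definition mnm_compl s m : 'X_{1..3} := [multinom (s - m i)%N | i < 3].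

Definition edge_gen i : R := 'X_[mnm_compl 1 U_(i)].

Definition eval_edge P : R := P.@[edge_gen].

HB.instance Definition _ := GRing.RMorphism.copy eval_edge (meval edge_gen).

(** The exponent of x_j in the product is the sum of the m_i with i different from j, that is s -
    m_j. *)
Lemma eval_edgeX s m : mdeg m = s -> eval_edge 'X_[m] = 'X_[mnm_compl s m].
Proof.
move=> <-; rewrite /eval_edge mevalX mprodXnE; congr 'X_[_].
apply/mnmP => j; rewrite mnm_sumE mnmE mdegE [in RHS](bigD1 j) //= addKn.
rewrite (bigD1 j) //= mulmnE mnmE mnm1E eqxx mul0n add0n.
by apply: eq_bigr => i /negPf ij; rewrite mulmnE mnmE mnm1E ij mul1n.
Qed.

Lemma eval_edgeU i : eval_edge 'X_i = edge_gen i.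
Proof. exact: mevalXU. Qed.

Lemma eval_edgeZ p P : eval_edge (p *: P) = p * eval_edge P.
Proof. exact: mevalZ. Qed.

Lemma eval_edgeE s P : tdeg s 0 P ->
  eval_edge P = \sum_(m <- msupp P) P@_m * 'X_[mnm_compl s m].
Proof.
move=> hP; rewrite {1}[P]mpolyE raddf_sum !big_seq; apply: eq_bigr => m /=.
rewrite mcoeff_msupp => /hP; rewrite addn0 => hm.
by rewrite eval_edgeZ (eval_edgeX hm).
Qed.

Lemma eval_koszul_rel i P : eval_edge (koszul_rel K i * P) = 0.
Proof.
rewrite rmorphM rmorphB /= !eval_edgeZ !eval_edgeU.
have h j : 'X_j * edge_gen j = 'X_[[multinom 1%N | i < 3]].
  rewrite -mpolyXD; congr 'X_[_]; apply/mnmP => l; rewrite mnmDE !mnmE.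
  by case: eqP.
by rewrite !h subrr mul0r.
Qed.

Lemma coef_eval_edge s P u : tdeg s 0 P -> (eval_edge P)@_u =
  \sum_(m <- msupp P) if (mnm_compl s m <= u)%MM then (P@_m)@_(u - mnm_compl s m) else 0.
Proof.
move=> hP; rewrite (eval_edgeE hP) raddf_sum /=; apply: eq_bigr => m _.
by rewrite mulrC mcoeffXM.
Qed.

(** At index 0 or 1 the image exponent is s - m_i + u_i with m_i or u_i zero, so it determines both;
    the degree s then fixes m_2. Hence no two monomials cancel. *)
Lemma normal_eval_edge_eq0 s P : tdeg s 0 P -> normal 0 P -> normal 1 P ->
  eval_edge P = 0 -> P = 0.
Proof.
move=> hP n0 n1 E; apply/mpolyP => m; apply/mpolyP => u; rewrite !mcoeff0.
apply/eqP; apply: contraT => nz.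
have Pm : m \in msupp P.
  by rewrite mcoeff_msupp; apply: contraNneq nz => ->; rewrite mcoeff0.
have /eqP := congr1 (mcoeff (mnm_compl s m + u)) E.
rewrite mcoeff0 (coef_eval_edge _ hP) (bigD1_seq m) //= lem_addr addmC addmK.
rewrite big_seq_cond big1 ?addr0 ?(negPf nz) // => m' /andP[Pm' ne].
case: ifP => // /mnm_lepP le; apply/eqP; apply: contraNT ne => nz'.
move: (n0 _ _ nz) (n1 _ _ nz) (n0 _ _ nz') (n1 _ _ nz') (le 0%R) (le 1%R).
move: Pm Pm'; rewrite !mcoeff_msupp => /hP + /hP.
rewrite !mdeg3 !mnmBE !mnmDE !mnmE => h h' a0 a1 b0 b1 l0 l1.
have e0 : m' 0%R = m 0%R by lia.
have e1 : m' 1%R = m 1%R by lia.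
by apply/eqP/mnm3P => //; lia.
Qed.

Lemma eval_edge_kernel s P : tdeg s 0 P -> eval_edge P = 0 ->
  exists a b, [/\ tdeg s 1 a, tdeg s 1 b &
    P = koszul_rel K 0 * a + koszul_rel K 1 * b].
Proof.
move=> hP E; have z0 : 0 != z by []; have z1 : 1 != z by [].
have [a [r [ha hr n0 _ defP]]] := division z0 hP.
have [b [r' [hb hr' n1 n0' defr]]] := division z1 hr.
exists a, b; split=> //; rewrite defP defr.
rewrite (normal_eval_edge_eq0 hr' _ n1) ?addr0 //; first exact: n0'.
by move: E; rewrite defP defr !raddfD /= !eval_koszul_rel !add0r.
Qed.

Lemma tdegP s P : tdeg s 0 P <-> P \is s.-homog.
Proof.
split=> [hP|/dhomogP hP m]; last by rewrite -mcoeff_msupp addn0 => /hP.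
by apply/dhomogP => m; rewrite mcoeff_msupp => /hP /=; rewrite addn0.
Qed.

Lemma tdegM s t P Q : tdeg s 0 P -> tdeg t 0 Q -> tdeg (s + t) 0 (P * Q).
Proof. by rewrite !tdegP; exact: dhomogM. Qed.

(** A common description of the edge ideal, with [s] equal to 1, and of its powers [exp_ideal], so
    that later results apply to both. *)
Definition is_edge_power (I : hideal K 3) s :=
  forall p, p \in hmem I <-> exists2 P, tdeg s 0 P & p = eval_edge P.

(** Some [mnm_compl s m] with |m| = s divides u exactly when the lower bounds s - min(u_i, s) for
    the m_i add up to at most s. *)
Lemma is_edge_power_coef I s p : is_edge_power I s ->
  p \in hmem I <->
  (forall u, p@_u != 0 -> (2 * s <= \sum_(i < 3) minn (u i) s)%N).
Proof.
have sum3 (F : 'I_3 -> nat) : (\sum_i F i = F 0%R + F 1%R + F z)%N.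
  rewrite 3!big_ord_recl big_ord0 addn0 addnA.
  by congr (F _ + F _ + F _)%N; apply: val_inj.
move=> hI; split=> [/hI[P hP ->] u|hp].
  rewrite (coef_eval_edge _ hP) big_seq => nz.
  have [m Pm le] : exists2 m, m \in msupp P & (mnm_compl s m <= u)%MM.
    apply/hasP; apply: contraNT nz => /hasPn h; rewrite big1 // => m /h.
    by move/negPf->.
  move: Pm; rewrite mcoeff_msupp => /hP; rewrite sum3 mdeg3.
  move/mnm_lepP: le => le; move: (le 0%R) (le 1%R) (le z); rewrite !mnmE.
  lia.
rewrite [p]mpolyE big_seq; apply: rpred_sum => u; rewrite mcoeff_msupp => /hp.
rewrite sum3 => hu; apply/hI.
(* [a] and [b] are the least admissible m_0 and m_1; the rest of the degree goes to m_2, and [hu]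
   makes it large enough. *)
pose a := (s - minn (u 0%R) s)%N; pose b := (s - minn (u 1%R) s)%N.
pose m : 'X_{1..3} := [multinom nth 0%N [:: a; b; (s - a - b)%N] i | i < 3].
have hm : mdeg m = s by rewrite mdeg3 !mnmE /= /a /b; lia.
have le : (mnm_compl s m <= u)%MM.
  apply/mnm_lepP => i; rewrite !mnmE.
  by case: (ord3P i) => -> /=; rewrite /a /b; lia.
exists ((p@_u *: 'X_[u - mnm_compl s m]) *: 'X_[m]).
  by apply: tdegZX; rewrite addn0.
rewrite eval_edgeZ (eval_edgeX hm) -scalerAl -mpolyXD addmC.
by rewrite addmC submK.
Qed.

(** The generators are listed so that the omitted variable has index 2, 1, 0; hence the reversal. *)
Lemma edge_gensE (i : 'I_3) : (edge_gens K)`_i = edge_gen (rev_ord i).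
Proof.
by case: (ord3P i) => -> /=; rewrite -mpolyXD; congr 'X_[_]; apply/mnm3P;
  rewrite mnmDE !mnmE.
Qed.

Lemma edge_ideal_power : is_edge_power (edge_ideal K) 1.
Proof.
move=> p; split=> [/gen_memE[a ->]|[P hP ->]].
  exists (\sum_(i < 3) a i *: 'X_(rev_ord i)).
    apply: (big_ind (tdeg 1 0)) => [||i _]; [exact: tdeg0|exact: tdegD|].
    by apply: tdegZX; rewrite mdeg1.
  rewrite raddf_sum; apply: eq_bigr => i _ /=.
  by rewrite eval_edgeZ eval_edgeU -edge_gensE.
rewrite (eval_edgeE hP) big_seq; apply: rpred_sum => m.
rewrite mcoeff_msupp => /hP; rewrite addn0 => /eqP/mdeg1P[i /eqP ->].
apply: hmemMl; apply/gen_memE; exists (fun j => (j == rev_ord i)%:R).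
rewrite (bigD1 (rev_ord i)) //= eqxx mul1r big1 => [|j /negPf ->]; last exact: mul0r.
by rewrite addr0 (edge_gensE (rev_ord i)) rev_ordK.
Qed.

Lemma exp_edge_ideal_power s : is_edge_power (exp_ideal (edge_ideal K) s) s.
Proof.
elim: s => [|s IH] p; split.
- move=> _; exists p%:MP; last by rewrite /eval_edge mevalC.
  by apply/tdegP; rewrite -alg_mpolyC; apply: rpredZ; exact: dhomog1.
- by [].
- move=> /mul_memE[l [/allP hl ->]].
  pose T q := exists2 P, tdeg s.+1 0 P & q = eval_edge P.
  rewrite big_seq; apply: (big_ind T).
  + by exists 0; rewrite ?raddf0 //; exact: tdeg0.
  + move=> _ _ [P hP ->] [Q hQ ->]; exists (P + Q); rewrite ?raddfD //.
    exact: tdegD.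
  + move=> ab /hl/andP[/edge_ideal_power[P hP ->] /IH[Q hQ ->]].
    by exists (P * Q); rewrite ?rmorphM // -add1n; exact: tdegM.
move=> [P hP ->]; rewrite (eval_edgeE hP) big_seq.
apply: (@rpred_sum _ (hmem (exp_ideal (edge_ideal K) s.+1))) => m.
rewrite mcoeff_msupp => /hP; rewrite addn0 => hm; apply: hmemMl.
(* Some T_i divides T^m; splitting it off gives g_i times a generator of the previous power. *)
have [i im] : exists i, (0 < m i)%N.
  have : mdeg m != 0%N by rewrite hm.
  rewrite mdeg3 !addn_eq0 !negb_and -!lt0n => /orP[/orP[]|] h.
  - by exists 0.
  - by exists 1.
  - by exists z.
have def_m : m = (U_(i) + (m - U_(i)))%MM by rewrite addmC submK ?lep1mP -?lt0n.
have hm' : mdeg (m - U_(i))%MM = s.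
  by move: hm; rewrite {1}def_m mdegD mdeg1 => -[].
apply/mul_memE; exists [:: (edge_gen i, 'X_[mnm_compl s (m - U_(i))])].
rewrite big_seq1 -(eval_edgeX hm) -(eval_edgeX hm') {2}def_m mpolyXD rmorphM /=.
rewrite eval_edgeU andbT; split=> //; apply/andP; split.
  apply/edge_ideal_power; exists 'X_i; last by rewrite eval_edgeU.
  by apply/tdegP; rewrite dhomogX /= mdeg1.
apply/IH; exists 'X_[m - U_(i)] => //.
by apply/tdegP; rewrite dhomogX /= hm'.
Qed.

End EdgeIdealPowers.

(** * The resolution *)

Definition monomials d : seq 'X_{1..3} :=
  [seq s2m t | t : d.-tuple 'I_3 <- enum (basis 3 d)].

Lemma mem_monomials d m : (m \in monomials d) = (mdeg m == d).
Proof. by rewrite basis_cover. Qed.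

Lemma uniq_monomials d : uniq (monomials d).
Proof. exact: uniq_basis. Qed.

Lemma size_monomials d : size (monomials d) = 'C(d + 2, 2).
Proof. by rewrite size_basis -bin_sub ?leq_addr // addKn. Qed.

(** The test keeps truncated subtraction from yielding the monomial 1 when k > s. *)
Definition shifted_monomials s k := if (k <= s)%N then monomials (s - k) else [::].

Lemma mem_shifted_monomials s k m :
  (m \in shifted_monomials s k) = (mdeg m + k == s)%N.
Proof.
rewrite /shifted_monomials; case: leqP => h; last by rewrite in_nil; lia.
by rewrite mem_monomials; lia.
Qed.

Lemma uniq_shifted_monomials s k : uniq (shifted_monomials s k).
Proof. by rewrite /shifted_monomials; case: ifP => // _; exact: uniq_monomials. Qed.

Lemma size_shifted_monomials s k : size (shifted_monomials s k) = 'C(s + 2 - k, 2).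
Proof.
rewrite /shifted_monomials; case: leqP => h /=; first by rewrite size_monomials addnBAC.
by rewrite bin_small //; lia.
Qed.

(** * From a resolution of an ideal to one of its quotient *)

Section AugmentQuotient.
Variables (K : fieldType) (n : nat) (I : hideal K n).
Local Notation R := {mpoly K[n]}.

Definition extend_grfree (F : grfree K n) (d0 : 'M[R]_(grank F 0, 1)) : grfree K n :=
  @GrFree K n (fun i => if i is i'.+1 then grank F i' else 1%N)
    (fun i => match i with 0 => fun=> 0 | i'.+1 => @gshift _ _ F i' end)
    (fun i => match i with 0 => d0 | i'.+1 => gdiff F i' end).

Lemma free_partE (F : grfree K n) i j (v : 'rV[R]_(grank F i)) :
  free_part j v <-> graded_mx (fun=> j) (@gshift _ _ F i) v.
Proof. by split=> [h k l|h l]; [rewrite ord1; exact: h|exact: h]. Qed.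

Lemma free_partM (F : grfree K n) i j (v : 'rV[R]_(grank F i.+1)) :
  graded_mx (@gshift _ _ F i.+1) (@gshift _ _ F i) (gdiff F i) ->
  free_part j v -> free_part j (v *m gdiff F i).
Proof. by move=> hd /free_partE hv; apply/free_partE; exact: graded_mxM hd. Qed.

Definition quot_eps (v : 'rV[R]_1) : quot_mod I := quot_pi I (v 0 0).

Lemma quot_eps_linear : linear quot_eps.
Proof.
move=> a u v; rewrite /quot_eps !mxE quot_piD; congr (_ + _).
exact/esym/quot_scaleE.
Qed.

HB.instance Definition _ := GRing.isLinear.Build R 'rV[R]_1 (quot_mod I) *:%R
  quot_eps quot_eps_linear.

(** As [eps] followed by the inclusion is [d0], both have the same kernel: exactness carries over,
    and surjectivity of [eps] becomes exactness at R. *)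
Lemma resolution_of_quotient (F : grfree K n)
    (eps : {linear 'rV[R]_(grank F 0) -> ideal_mod I}) (d0 : 'M[R]_(grank F 0, 1)) :
  (forall v, ideal_val (eps v) = (v *m d0) 0 0) ->
  augmented_resolution eps -> graded_resolution (extend_grfree d0) (quot_mod I).
Proof.
move=> epsE [h1 h2 h3 h4 h5].
have val0 (v : 'rV[R]_(grank F 0)) : eps v = 0 <-> v *m d0 = 0.
  split=> [/(congr1 val)|h].
    rewrite /= epsE => h; apply/rowP => k; rewrite (ord1 k) h mxE.
    exact: raddf0.
  by apply: val_inj; rewrite /= epsE h mxE [RHS]raddf0.
exists [the {linear 'rV[R]_(grank (extend_grfree d0) 0) -> quot_mod I} of quot_eps].
split=> /=.
- case=> [|i] j v; last exact: h1.
  move=> hv k; rewrite (ord1 k) /= subr0 -epsE.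
  by have := h2 j v hv.
- by move=> j v hv; exists (v 0 0) => //; have := hv 0; rewrite /= subr0.
- move=> u; exists (\row_k quot_repr u); rewrite /quot_eps mxE.
  exact: quot_reprK.
- move=> v; rewrite /quot_eps -(raddf0 (quot_pi I)) quot_pi_eq subr0; split.
    move=> hv; have [w hw] := h3 (IdealSub hv); exists w.
    by apply/rowP => k; rewrite (ord1 k) -epsE hw.
  by move=> [w ->]; rewrite -epsE; exact: valP.
- by case=> [|i] v; [rewrite -val0; exact: h4 | exact: h5].
Qed.

End AugmentQuotient.

(** * The part of T-degree s of the Koszul complex, in matrices *)

Section EdgeResolution.
Variables (K : fieldType) (s : nat).
Local Notation R := {mpoly K[3]}.
Local Notation S := {mpoly R[3]}.
Local Notation B k := (shifted_monomials s k).

Definition row_poly k (v : 'rV[R]_(size (B k))) : S :=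
  \sum_i v 0 i *: 'X_[nth 0%MM (B k) i].

Definition poly_row k (P : S) : 'rV[R]_(size (B k)) :=
  \row_i P@_(nth 0%MM (B k) i).

Lemma row_poly_linear k : linear (@row_poly k).
Proof.
move=> a u v; rewrite /row_poly scaler_sumr -big_split; apply: eq_bigr => i _ /=.
by rewrite !mxE scalerDl scalerA.
Qed.

HB.instance Definition _ k := GRing.isLinear.Build R 'rV[R]_(size (B k)) S *:%R
  (@row_poly k) (@row_poly_linear k).

Lemma mdeg_nth_shifted k (i : 'I_(size (B k))) :
  (mdeg (nth 0%MM (B k) i) + k = s)%N.
Proof. by apply/eqP; rewrite -mem_shifted_monomials mem_nth. Qed.

Lemma tdeg_row_poly k (v : 'rV[R]_(size (B k))) : tdeg s k (row_poly v).
Proof.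
apply: (big_ind (tdeg s k)) => [||i _]; [exact: tdeg0|exact: tdegD|].
by apply: tdegZX; exact: mdeg_nth_shifted.
Qed.

Lemma row_polyK k : cancel (@row_poly k) (@poly_row k).
Proof.
move=> v; apply/rowP => i; rewrite mxE raddf_sum (bigD1 i) //= mcoeffZ mcoeffX eqxx.
rewrite mulr1 big1 ?addr0 // => j ne; rewrite mcoeffZ mcoeffX.
by rewrite nth_uniq ?uniq_shifted_monomials // (inj_eq val_inj) (negPf ne) mulr0.
Qed.

Lemma poly_rowK k P : tdeg s k P -> row_poly (poly_row k P) = P.
Proof.
move=> hP; apply/mpolyP => m; have [mB|mB] := boolP (m \in B k).
  pose i := Ordinal (etrans (index_mem m (B k)) mB).
  have := congr1 (fun v : 'rV_(size (B k)) => v 0 i) (row_polyK (poly_row k P)).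
  by rewrite !mxE /= nth_index.
have vanish Q : tdeg s k Q -> Q@_m = 0.
  by move=> hQ; apply/eqP; apply: contraNT mB => /hQ/eqP; rewrite mem_shifted_monomials.
by rewrite !vanish //; exact: tdeg_row_poly.
Qed.

(** Multiplication by [koszul_rel K i] in the monomial bases. *)
Definition koszul_mx k i : 'M[R]_(size (B k.+1), size (B k)) :=
  \matrix_(a, b) (koszul_rel K i * 'X_[nth 0%MM (B k.+1) a])@_(nth 0%MM (B k) b).

Lemma row_poly_koszul k i (v : 'rV_(size (B k.+1))) :
  row_poly (v *m koszul_mx k i) = koszul_rel K i * row_poly v.
Proof.
rewrite -[RHS](poly_rowK (tdeg_koszul_rel (i := i) (@tdeg_row_poly _ v))).
congr row_poly.
apply/rowP => b; rewrite !mxE mulr_sumr raddf_sum; apply: eq_bigr => a _ /=.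
by rewrite mxE -scalerAr mcoeffZ.
Qed.

Lemma koszul_mx_entry k i a b :
  (koszul_mx k i a b) \is 1.-homog.
Proof.
have homogX j m m' : (diag_var K j * 'X_[m])@_m' \is 1.-homog.
  rewrite mcoeff_diag_var mcoeffX; case: ifP => _; last by rewrite mulr0 dhomog0.
  by case: eqP => _; rewrite ?mulr0 ?dhomog0 // mulr1 dhomogX /= mdeg1.
by rewrite mxE mulrBl mcoeffB; apply: rpredB; exact: homogX.
Qed.

Lemma row_poly_koszul_pair (p q : 'rV[R]_(size (B 1))) :
  row_poly (row_mx p q *m col_mx (koszul_mx 0 0) (koszul_mx 0 1)) =
  koszul_rel K 0 * row_poly p + koszul_rel K 1 * row_poly q.
Proof.
by rewrite mul_row_col raddfD; congr (_ + _); exact: row_poly_koszul.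
Qed.

Lemma koszul_exact0 (v : 'rV[R]_(size (B 0))) : eval_edge (row_poly v) = 0 <->
  exists w, v = w *m col_mx (koszul_mx 0 0) (koszul_mx 0 1).
Proof.
split=> [/(eval_edge_kernel (@tdeg_row_poly _ v))[a [b [ha hb E]]]|[w ->]].
  exists (row_mx (poly_row 1 a) (poly_row 1 b)); apply: (can_inj (@row_polyK 0)).
  by rewrite E row_poly_koszul_pair (poly_rowK ha) (poly_rowK hb).
rewrite -[w]hsubmxK row_poly_koszul_pair raddfD -[RHS]addr0.
by congr (_ + _); exact: eval_koszul_rel.
Qed.

Lemma koszul_exact1 (v : 'rV[R]_(size (B 1) + size (B 1))) :
  v *m col_mx (koszul_mx 0 0) (koszul_mx 0 1) = 0 <->
  exists w, v = w *m row_mx (koszul_mx 1 1) (- koszul_mx 1 0).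
Proof.
rewrite -[v]hsubmxK; move: (lsubmx v) (rsubmx v) => p q.
split=> [/(congr1 (@row_poly 0))|[w]].
  rewrite raddf0 row_poly_koszul_pair => E.
  have [//|//|//|c [hc pE qE]] := koszul_exact _ _ _ (@tdeg_row_poly _ p) E.
  have koszulK i : row_poly (poly_row 2 c *m koszul_mx 1 i) = koszul_rel K i * c.
    by rewrite row_poly_koszul; congr (_ * _); exact: poly_rowK.
  exists (poly_row 2 c); rewrite mul_mx_row mulmxN.
  congr row_mx; apply: (can_inj (@row_polyK 1)).
    by rewrite pE; exact/esym/koszulK.
  by rewrite qE [RHS]raddfN; congr (- _); exact/esym/koszulK.
rewrite mul_mx_row mulmxN => /eq_row_mx[-> ->]; apply: (can_inj (@row_polyK 0)).
rewrite raddf0 row_poly_koszul_pair.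
have swap (x y t : S) : x * (y * t) + y * - (x * t) = 0.
  by rewrite mulrN mulrCA subrr.
apply: etrans (swap (koszul_rel K 0) (koszul_rel K 1) (row_poly w)).
congr (_ * _ + _ * _); first exact: row_poly_koszul.
by rewrite raddfN; congr (- _); exact: row_poly_koszul.
Qed.

Lemma koszul_exact2 (v : 'rV[R]_(size (B 2))) :
  v *m row_mx (koszul_mx 1 1) (- koszul_mx 1 0) = 0 -> v = 0.
Proof.
rewrite mul_mx_row -row_mx0 => /eq_row_mx[/(congr1 (@row_poly 1)) + _].
rewrite raddf0 row_poly_koszul => h; apply: (can_inj (@row_polyK 2)).
by rewrite raddf0; apply: koszul_rel_inj h.
Qed.

Definition edge_rank i : nat :=
  match i with
  | 0 => size (B 0) | 1 => size (B 1) + size (B 1) | 2 => size (B 2) | _ => 0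
  end.

Definition edge_diff i : 'M[R]_(edge_rank i.+1, edge_rank i) :=
  match i with
  | 0 => col_mx (koszul_mx 0 0) (koszul_mx 0 1)
  | 1 => row_mx (koszul_mx 1 1) (- koszul_mx 1 0)
  | _ => 0
  end.

(** The generators have degree 2s and each differential is linear in the x_i, so the shift grows by
    one per step. *)
Definition edge_free : grfree K 3 :=
  @GrFree K 3 edge_rank (fun i _ => (2 * s + i)%N%:Z) edge_diff.

Definition edge_aug : 'M[R]_(edge_rank 0, 1) :=
  \col_i 'X_[mnm_compl s (nth 0%MM (B 0) i)].

Lemma mul_edge_aug (v : 'rV[R]_(edge_rank 0)) :
  (v *m edge_aug) 0 0 = eval_edge (row_poly v).
Proof.
rewrite mxE raddf_sum; apply: eq_bigr => i _ /=.
by rewrite mxE eval_edgeZ (@eval_edgeX K s) // -[LHS]addn0 mdeg_nth_shifted.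
Qed.

Lemma edge_diff_homog i a b : edge_diff i a b \is 1.-homog.
Proof.
case: i a b => [|[|i]] a b /=; last by rewrite mxE dhomog0.
  by rewrite mxE; case: split => ?; exact: koszul_mx_entry.
rewrite mxE; case: split => ?; first exact: koszul_mx_entry.
by rewrite mxE rpredN; exact: koszul_mx_entry.
Qed.

Lemma edge_aug_homog a b : edge_aug a b \is (2 * s).-homog.
Proof.
rewrite mxE dhomogX /= mdeg3 !mnmE; apply/eqP.
by have := mdeg_nth_shifted a; rewrite mdeg3; lia.
Qed.

Lemma edge_free_minimal : minimal edge_free.
Proof.
move=> i k l; apply: (dhomog_nemf_coeff (mf := mdeg) (edge_diff_homog k l)).
by rewrite /= mdeg0.
Qed.

(** For s = 0 the only generator would be the unit 1. *)
Lemma edge_extend_minimal : (0 < s)%N -> minimal (extend_grfree (F := edge_free) edge_aug).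
Proof.
move=> s_gt0 [|i] k l; last exact: edge_free_minimal.
by apply: (dhomog_nemf_coeff (mf := mdeg) (edge_aug_homog k l)); rewrite /= mdeg0; lia.
Qed.

Variables (I : hideal K 3) (hI : is_edge_power I s).

Lemma mul_edge_aug_mem (v : 'rV[R]_(grank edge_free 0)) : (v *m edge_aug) 0 0 \in hmem I.
Proof.
apply/hI; exists (row_poly (v : 'rV_(size (B 0)))); rewrite ?mul_edge_aug //.
exact: tdeg_row_poly.
Qed.

Definition edge_eps (v : 'rV[R]_(grank edge_free 0)) : ideal_mod I :=
  IdealSub (mul_edge_aug_mem v).

Lemma edge_eps_linear : linear edge_eps.
Proof.
move=> a u v; apply: val_inj; rewrite linearP /=.
by rewrite mulmxDl -scalemxAl !mxE.
Qed.

HB.instance Definition _ := GRing.isLinear.Build R 'rV[R]_(grank edge_free 0)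
  (ideal_mod I) *:%R edge_eps edge_eps_linear.

Lemma edge_eps_resolution : augmented_resolution edge_eps.
Proof.
split.
- move=> i j v; apply: free_partM => k l /=.
  have -> : (2 * s + i.+1)%N%:Z - (2 * s + i)%N%:Z = 1 by lia.
  exact: edge_diff_homog.
- move=> j v hv; rewrite /part /= /ideal_part /= mxE; apply: poly_part_sum => k _.
  have := hv k; rewrite /= addn0 => hvk; rewrite -[j](subrK (2 * s)%N%:Z).
  by apply: (poly_partM hvk (_ : poly_part (2 * s)%N _)); exact: edge_aug_homog.
- move=> u; have /hI[P hP uE] := valP u; exists (poly_row 0 P); apply: val_inj.
  by rewrite /= mul_edge_aug poly_rowK // -uE.
- move=> v; rewrite -(@koszul_exact0 v) -mul_edge_aug.
  split=> [/(congr1 val)|h]; first by rewrite /= [X in _ = X -> _]raddf0.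
  by apply: val_inj; rewrite [RHS]raddf0.
(* Exactness at the middle module, injectivity of the last map, and zero modules beyond. *)
case=> [|[|i]] v /=.
- exact: koszul_exact1.
- split=> [/koszul_exact2 ->|[w ->]]; last by rewrite mulmx0 mul0mx.
  by exists 0; rewrite mul0mx.
- split=> _; last by rewrite mulmx0.
  by exists 0; rewrite mul0mx; apply: thinmx0.
Qed.

End EdgeResolution.

(** * The Hilbert series *)

Definition clipped_degree s (u : 'X_{1..3}) := (\sum_(i < 3) minn (u i) s)%N.

Lemma clipped_degree3 s u : clipped_degree s u =
  (minn (u 0%R) s + minn (u 1%R) s + minn (u ord_max) s)%N.
Proof.
rewrite /clipped_degree 3!big_ord_recl big_ord0 addn0 addnA.
by congr (minn (u _) _ + minn (u _) _ + minn (u _) _)%N; apply: val_inj.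
Qed.

(** By [is_edge_power_coef] these are the monomials outside the ideal. *)
Definition standard_monomials s d :=
  [seq u <- monomials d | (clipped_degree s u < 2 * s)%N].

Lemma mem_standard_monomials s d u : (u \in standard_monomials s d) =
  (mdeg u == d) && (clipped_degree s u < 2 * s)%N.
Proof. by rewrite mem_filter mem_monomials andbC. Qed.

Lemma uniq_standard_monomials s d : uniq (standard_monomials s d).
Proof. exact/filter_uniq/uniq_monomials. Qed.

Lemma size_standard_small s d : (d < 2 * s)%N ->
  size (standard_monomials s d) = 'C(d + 2, 2).
Proof.
move=> lt_ds; rewrite /standard_monomials (_ : filter _ _ = monomials d).
  exact: size_monomials.
apply/all_filterP/allP => u; rewrite mem_monomials mdeg3 clipped_degree3; lia.
Qed.

Definition mnm3 (a b c : nat) : 'X_{1..3} := [multinom nth 0%N [:: a; b; c] i | i < 3].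

(** For positive s, a standard monomial here has exactly one pair of exponents with sum below s, as
    two such pairs would bound the degree by 2s - 2. Each pair accounts for C(s + 1, 2)
    monomials. *)
Lemma size_standard_large s d : (2 * s <= d)%N ->
  size (standard_monomials s d) = (3 * 'C(s + 1, 2))%N.
Proof.
case: s => [|s] le_sd.
  rewrite bin_small // muln0; apply/eqP; rewrite size_eq0 -[_ == _]negbK.
  by rewrite -has_filter; apply/hasPn => u _; rewrite -leqNgt.
(* From here [s] is the original value minus one. A monomial [m] of degree [s] records the two small
   exponents and their slack; [c m] is the large exponent. *)
pose c (m : 'X_{1..3}) := (d - m 0%R - m 1%R)%N.
pose f0 (m : 'X_{1..3}) := mnm3 (c m) (m 0%R) (m 1%R).
pose f1 (m : 'X_{1..3}) := mnm3 (m 0%R) (c m) (m 1%R).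
pose f2 (m : 'X_{1..3}) := mnm3 (m 0%R) (m 1%R) (c m).
have inj_on (f : 'X_{1..3} -> 'X_{1..3}) :
    (forall m m', f m = f m' -> m 0%R = m' 0%R /\ m 1%R = m' 1%R) ->
    uniq [seq f m | m <- monomials s].
  move=> hf; rewrite map_inj_in_uniq ?uniq_monomials // => m m'.
  rewrite !mem_monomials !mdeg3 => /eqP hm /eqP hm' /hf[h0 h1].
  by apply: mnm3P => //; lia.
have mem_on (f : 'X_{1..3} -> 'X_{1..3}) u (a b : nat) :
    (forall m, mdeg m = s -> f m = u <-> (mdeg u = d /\ m 0%R = a /\ m 1%R = b)) ->
    (u \in [seq f m | m <- monomials s]) = (mdeg u == d) && (a + b <= s)%N.
  move=> hf; apply/mapP/andP => [[m]|[/eqP du ab]].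
    rewrite mem_monomials => /eqP dm /esym/(hf _ dm)[du [<- <-]].
    by move: dm; rewrite mdeg3; split; [exact/eqP|lia].
  have dm : mdeg (mnm3 a b (s - a - b)) = s by rewrite mdeg3 !mnmE /=; lia.
  exists (mnm3 a b (s - a - b)); first by rewrite mem_monomials dm.
  by apply/esym/hf => //; rewrite !mnmE.
have charf (f : 'X_{1..3} -> 'X_{1..3}) (i j k : 'I_3) u :
    (forall m, f m i = m 0%R /\ f m j = m 1%R /\ f m k = c m) ->
    (forall v, mdeg v = v i + v j + v k)%N ->
    (forall v w : 'X_{1..3}, v i = w i -> v j = w j -> v k = w k -> v = w) ->
    (u \in [seq f m | m <- monomials s]) = (mdeg u == d) && (u i + u j <= s)%N.
  move=> hf hd ext; apply: mem_on => m; rewrite mdeg3 => dm.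
  have [fi [fj fk]] := hf m; split=> [<-|[du [mi mj]]].
    by rewrite hd fi fj fk /c; split => //; lia.
  by apply: ext; rewrite ?fi ?fj ?fk // /c mi mj; move: du; rewrite hd; lia.
pose L := [seq f0 m | m <- monomials s] ++ [seq f1 m | m <- monomials s]
          ++ [seq f2 m | m <- monomials s].
have mem0 u : (u \in [seq f0 m | m <- monomials s])
    = (mdeg u == d) && (u 1%R + u ord_max <= s)%N.
  apply: (charf f0 _ _ 0%R) => [m|v|v w *]; rewrite ?mnmE ?mdeg3 //; first lia.
  exact: mnm3P.
have mem1 u : (u \in [seq f1 m | m <- monomials s])
    = (mdeg u == d) && (u 0%R + u ord_max <= s)%N.
  apply: (charf f1 _ _ 1%R) => [m|v|v w *]; rewrite ?mnmE ?mdeg3 //; first lia.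
  exact: mnm3P.
have mem2 u : (u \in [seq f2 m | m <- monomials s])
    = (mdeg u == d) && (u 0%R + u 1%R <= s)%N.
  apply: (charf f2 _ _ ord_max) => [m|v|v w *]; rewrite ?mnmE ?mdeg3 //.
  exact: mnm3P.
have -> : size (standard_monomials s.+1 d) = size L.
  apply/perm_size/uniq_perm; first exact: uniq_standard_monomials.
    rewrite !cat_uniq; apply/and5P; split.
    - apply: inj_on => m m' /mnmP h.
      by have := (h 1%R, h ord_max); rewrite !mnmE /= => -[].
    - rewrite has_cat negb_or; apply/andP; split; apply/hasPn => u.
        by rewrite mem1 /= mem0 mdeg3; lia.
      by rewrite mem2 /= mem0 mdeg3; lia.
    - apply: inj_on => m m' /mnmP h.
      by have := (h 0%R, h ord_max); rewrite !mnmE /= => -[].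
    - by apply/hasPn => u; rewrite mem2 /= mem1 mdeg3; lia.
    - apply: inj_on => m m' /mnmP h.
      by have := (h 0%R, h 1%R); rewrite !mnmE /= => -[].
  move=> u; rewrite mem_standard_monomials !mem_cat mem0 mem1 mem2.
  rewrite clipped_degree3 mdeg3; lia.
rewrite /L !size_cat (size_map f0) (size_map f1) (size_map f2) size_monomials.
by rewrite addSnnS !mulSn addn0.
Qed.

Section HilbertSeries.
Variables (K : fieldType) (s : nat) (I : hideal K 3).
Hypothesis hI : is_edge_power I s.
Local Notation R := {mpoly K[3]}.
Local Notation B d := (standard_monomials s d).

Lemma grdim_quotient d : grdim (quot_mod I) d%:Z (size (B d)).
Proof.
pose X (k : 'I_(size (B d))) : 'X_{1..3} := nth 0%MM (B d) k.
have XP k : mdeg (X k) = d /\ (clipped_degree s (X k) < 2 * s)%N.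
  have := mem_nth 0%MM (ltn_ord k); rewrite mem_standard_monomials.
  by case/andP => /eqP.
exists (fun k => quot_pi I 'X_[X k]); split=> [k|_ [p hp ->]].
  by exists 'X_[X k] => //=; rewrite dhomogX /= (XP k).1.
pose comb (c : {ffun 'I_(size (B d)) -> K}) : R := \sum_k c k *: 'X_[X k].
have combE (c : {ffun 'I_(size (B d)) -> K}) :
    \sum_k (c k)%:MP *: (quot_pi I 'X_[X k] : quot_mod I) = quot_pi I (comb c).
  rewrite raddf_sum; apply: eq_bigr => k _ /=.
  by rewrite -mul_mpolyC; exact: quot_scaleE.
have comb_coef (c : {ffun 'I_(size (B d)) -> K}) k : (comb c)@_(X k) = c k.
  rewrite raddf_sum (bigD1 k) //= mcoeffZ mcoeffX eqxx mulr1.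
  rewrite big1 ?addr0 // => l ne; rewrite mcoeffZ mcoeffX.
  by rewrite nth_uniq ?uniq_standard_monomials // (inj_eq val_inj) (negPf ne) mulr0.
have comb_supp c u : (comb c)@_u != 0 -> u \in B d.
  apply: contraNT => uB; rewrite raddf_sum big1 //= => k _.
  rewrite mcoeffZ mcoeffX; case: eqP => [E|_]; last by rewrite mulr0.
  by rewrite -E mem_nth in uB.
(* Membership is tested coefficient by coefficient, so only coefficients at standard monomials
   matter; existence and uniqueness of coordinates both follow. *)
have key c : quot_pi I p = quot_pi I (comb c) <-> forall k, p@_(X k) = c k.
  rewrite quot_pi_eq (is_edge_power_coef _ hI); split=> [h k|h u].
    apply/eqP; rewrite -(comb_coef c) -subr_eq0 -mcoeffB.
    apply: contraT => /h; rewrite leqNgt -/(clipped_degree s (X k)).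
    by rewrite (XP k).2.
  have [uB|uB] := boolP (u \in B d).
    have lt_i : (index u (B d) < size (B d))%N by rewrite index_mem.
    have := h (Ordinal lt_i); rewrite -comb_coef /X /= nth_index // => E.
    by rewrite mcoeffB E subrr eqxx.
  rewrite mcoeffB (_ : (comb c)@_u = 0); last first.
    by apply/eqP; apply: contraNT uB; exact: comb_supp.
  rewrite subr0 -mcoeff_msupp => pu; have /= du := dhomog_mf (hp : p \is d.-homog) pu.
  by move: uB; rewrite mem_standard_monomials du eqxx /= -leqNgt.
exists [ffun k => p@_(X k)]; split.
  by rewrite combE; apply/key => k; rewrite ffunE.
by move=> c; rewrite combE => /key h; apply/ffunP => k; rewrite ffunE.
Qed.

Lemma hilbert_series_quotient :
  hilbert_series (quot_mod I) (fun d => size (B d)).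
Proof.
split=> [d|d]; first exact: grdim_quotient.
exists (fun k : 'I_0 => 0); split; first by case.
move=> _ [_ -> ->]; exists [ffun=> 0]; split; first by rewrite big_ord0 raddf0.
by move=> c _; apply/ffunP => -[].
Qed.

End HilbertSeries.

Lemma hilbert_numerator_coef s m : (hilbert_numerator s)`_m =
  (if (m < 2 * s)%N then m.+1%:Z else 0)
  - (if m == (2 * s)%N then 'C(s + 2, 2)%:Z - (2 * s)%:Z - 1 else 0).
Proof.
rewrite coefB coefZ coefXn coef_sum; congr (_ - _); last first.
  by case: eqP; rewrite ?mulr1 ?mulr0.
under eq_bigr do rewrite coefZ coefXn.
case: ltnP => [lt_ms|le_sm].
  rewrite (bigD1 (Ordinal lt_ms)) //= eqxx mulr1 big1 ?addr0 // => i ne.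
  by rewrite -(inj_eq val_inj) /= eq_sym in ne; rewrite (negPf ne) mulr0.
rewrite big1 // => i _; case: eqP => [E|_]; last by rewrite mulr0.
by have := ltn_ord i; rewrite -E ltnNge le_sm.
Qed.

(** Multiplying by 1 - t takes consecutive differences: d + 1 in degree d < 2s, then 3 C(s + 1, 2) -
    C(2s + 1, 2) = - C(s, 2) in degree 2s, and 0 above. *)
Lemma power_series_standard s :
  power_series_quotient (fun d => size (standard_monomials s d))
    (hilbert_numerator s) (1 - 'X).
Proof.
split; first by rewrite coefB coef1 coefX subr0.
have D n : (1 - 'X : {poly int})`_n = (n == 0%N)%:R - (n == 1%N)%:R.
  by rewrite coefB coef1 coefX.
have binS2 n : ('C(n.+1 + 2, 2) = 'C(n + 2, 2) + n.+2)%N.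
  by rewrite !addn2 binS bin1 addnC.
have bin2E n : (2 * 'C(n + 2, 2) = n.+2 * n.+1)%N.
  by rewrite addn2 -mul_bin_diag bin1.
have count d : size (standard_monomials s d) =
    if (d < 2 * s)%N then 'C(d + 2, 2) else (3 * 'C(s + 1, 2))%N.
  by case: ltnP => h; [exact: size_standard_small|exact: size_standard_large].
move=> m; rewrite hilbert_numerator_coef big_ord_recr /= subnn D /= subr0 mulr1.
case: m => [|m].
  rewrite big_ord0 add0r count; have [->//|s_gt0] := posnP s.
  have -> : (0 == 2 * s)%N = false by lia.
  by have -> : (0 < 2 * s)%N by lia.
rewrite big_ord_recr /= subSnn D /= sub0r mulrN mulr1 big1 => [|i _].
  have := bin2E s; have -> : 'C(s + 2, 2) = ('C(s + 1, 2) + s.+1)%N.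
    by rewrite addn2 addn1 binS bin1 addnC.
  rewrite add0r !count; move: ('C(s + 1, 2)) (binS2 m) (bin2E m) => c.
  case: (ltngtP m.+1 (2 * s)) => h /=; first by lia.
    by lia.
  by nia.
have lt_im : (i < m)%N := ltn_ord i.
by rewrite D subSn ?(ltnW lt_im) // eqSS subn_eq0 leqNgt lt_im subrr mulr0.
Qed.

(** * Resolution form and regularity *)

Section Conclusion.
Variables (K : fieldType) (s : nat) (I : hideal K 3).
Hypotheses (s_gt0 : (0 < s)%N) (hI : is_edge_power I s).

Lemma edge_power_resolution_form :
  minimal_resolution_form (quot_mod I)
    [:: (1%N, 0);
        ('C(s + 2, 2), (2 * s)%N%:Z);
        ((2 * 'C(s + 1, 2))%N, (2 * s + 1)%N%:Z);
        ('C(s, 2), (2 * s + 2)%N%:Z)].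
Proof.
have res : graded_resolution (extend_grfree (F := edge_free K s) (edge_aug K s))
    (quot_mod I).
  by apply: (resolution_of_quotient _ (edge_eps_resolution hI)).
have min := @edge_extend_minimal K s s_gt0.
split=> [|F resF minF]; first by eexists; split; [exact: res|exact: min].
apply: (minimal_has_form resF res minF min) => -[|[|[|[|i]]]].
- by split.
- rewrite /= size_shifted_monomials subn0; split=> // k; by rewrite addn0.
- by rewrite /= size_shifted_monomials addnn -mul2n -addnBA.
- by rewrite /= size_shifted_monomials addnK.
- by rewrite /= nth_nil; split=> // -[].
Qed.

(** The i-th module of the minimal resolution is generated in degree 2s + i, so all nonzero Tor lies
    on one diagonal. *)
Lemma edge_power_regularity : is_regularity (ideal_mod I) (2 * s)%N%:Z.
Proof.
have res : graded_resolution (edge_free K s) (ideal_mod I).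
  by exists [the {linear _ -> _} of edge_eps hI]; exact: edge_eps_resolution.
have min := @edge_free_minimal K s; split=> [|i j].
  exists 0%N, (2 * s)%N%:Z; split; last exact: subr0.
  exists (edge_free K s); split=> //.
  have lt0 : (0 < grank (edge_free K s) 0)%N.
    by rewrite /= size_shifted_monomials subn0 bin_gt0 leq_addl.
  (* A basis vector is no boundary: by minimality all boundaries vanish modulo the variables. *)
  exists (delta_mx 0 (Ordinal lt0)); split=> //.
    by move=> k _ /=; rewrite addn0.
  move=> [w [_]]; rewrite minimal_tensor_diff // mulmx0.
  move/matrixP/(_ 0 (Ordinal lt0)); rewrite !mxE !eqxx => /eqP.
  by rewrite oner_eq0.
move=> [F [resF [v [pv cv nbv]]]].
by have [k /= <-] := Tor_of_minimal resF res min pv cv nbv; lia.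
Qed.

End Conclusion.

Theorem theorem4p3 (K : fieldType) :
  minimal_resolution_form (quot_mod (edge_ideal K))
    [:: (1%N, 0); (3%N, 2); (2%N, 3)]
  /\
  forall s : nat, (2 <= s)%N ->
    [/\ minimal_resolution_form (quot_mod (exp_ideal (edge_ideal K) s))
          [:: (1%N, 0);
              ('C(s + 2, 2), (2 * s)%N%:Z);
              ((2 * 'C(s + 1, 2))%N, (2 * s + 1)%N%:Z);
              ('C(s, 2), (2 * s + 2)%N%:Z)],
        is_regularity (ideal_mod (exp_ideal (edge_ideal K) s)) (2 * s)%N%:Z
      & exists h : nat -> nat,
          hilbert_series (quot_mod (exp_ideal (edge_ideal K) s)) h /\
          power_series_quotient h (hilbert_numerator s) (1 - 'X)].
Proof.
split=> [|s s_gt1].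
  have [ex form] := edge_power_resolution_form (isT : (0 < 1)%N) (@edge_ideal_power K).
  split=> // F resF minF i; have [rF sF] := form F resF minF i.
  (* For s = 1 the general list ends with an entry of rank C(1, 2) = 0, so the ranks agree with the
     shorter list, and shift conditions at rank 0 are vacuous. *)
  case: i rF sF => [|[|[|[|i]]]] //= rF _; rewrite ?nth_nil in rF *; split=> // k.
    by have := ltn_ord k; rewrite [X in (_ < X)%N]rF.
  by have := ltn_ord k; rewrite [X in (_ < X)%N]rF.
have hI := @exp_edge_ideal_power K s; have s_gt0 := ltnW s_gt1; split.
- exact: edge_power_resolution_form.
- exact: edge_power_regularity.
- exists (fun d => size (standard_monomials s d)); split.
    exact: hilbert_series_quotient.
  exact: power_series_standard.
Qed.
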